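(* Let $\Lambda=\Lambda_6^{\mathcal{E}}$ be the Coxeter-Todd lattice and $L=\Lambda\oplus II_{1,1}^{\mathcal{E}}\cong I_{7,1}^{\mathcal{E}}$. (i) If $v\in L$ is primitive, isotropic and not equivalent to a multiple of $\rho$ under $\mathrm{Reflec}_0\,L$, then $v^\perp/\langle v\rangle\cong\mathcal{E}^6$. (ii) $\mathrm{Aut}\,L=\mathrm{Reflec}\,L$. In particular, $L$ is reflective.
   Context: $\mathcal{E}=\mathbb{Z}[\omega]$, $\omega=(-1+\sqrt{-3})/2$, $\theta=\omega-\bar\omega=\sqrt{-3}$. An $\mathcal{E}$-lattice is a free $\mathcal{E}$-module of finite rank with an $\mathcal{E}$-valued Hermitian form $\langle\cdot|\cdot\rangle$, conjugate-linear in the first variable and linear in the second; isomorphism means isometry. $\mathcal{E}^n$ carries the form $\sum\bar x_iy_i$, and $I_{7,1}^{\mathcal{E}}$ is $\mathcal{E}^8$ with form $\mathrm{diag}[1,1,1,1,1,1,1,-1]$. The Coxeter-Todd lattice is $$\Lambda_6^{\mathcal{E}}=\tfrac1\theta\{(x_1,\dots,x_6)\in\mathcal{E}^6: x_i\equiv x_j\ (\mathrm{mod}\ \theta),\ \textstyle\sum x_i\equiv0\ (\mathrm{mod}\ 3)\}$$ with form $\sum\bar x_iy_i$. $II_{1,1}^{\mathcal{E}}$ is $\mathcal{E}^2$ with inner product matrix $\begin{pmatrix}0&1\\1&0\end{pmatrix}$. Elements of $L$ are written $(\lambda;\mu,\nu)$ with $\lambda\in\Lambda$, $\mu,\nu\in\mathcal{E}$;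 $\rho=(0;0,1)$. The norm of $v$ is $v^2=\langle v|v\rangle$; $v$ is isotropic if $v^2=0$. A nonzero $v\in L$ is primitive if $v=w\alpha$ with $w\in L$, $\alpha\in\mathcal{E}$ implies $\alpha$ is a unit. $\langle v\rangle$ is the $\mathcal{E}$-span of $v$, and $v^\perp$ is its orthogonal complement in $L$; $v^\perp/\langle v\rangle$ carries the induced form. For $r\in L\otimes\mathbb{R}$ of nonzero norm and a root of unity $\xi\ne1$, the $\xi$-reflection in $r$ is $v\mapsto v-r(1-\xi)\langle r|v\rangle/r^2$. $\mathrm{Reflec}\,L$ is the subgroup of $\mathrm{Aut}\,L$ generated by those elements of $\mathrm{Aut}\,L$ that are reflections in positive-norm vectors; $L$ is reflective if this has finite index in $\mathrm{Aut}\,L$. $\mathrm{Reflec}_0\,L$ is the subgroup generated by the reflections ($\xi$-reflections for units $\xi$ of $\mathcal{E}$) in the short roots (norm $1$ vectors) of $L$. *)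

(* Defs.v *)
From HB Require Import structures.
From mathcomp Require Import all_boot all_order all_algebra.
From mathcomp Require Import ring_quotient complex.
From mathcomp Require Import boolp classical_sets reals.
From mathcomp Require Import ring.

Set Implicit Arguments.
Unset Strict Implicit.
Unset Printing Implicit Defensive.

Import Order.TTheory GRing.Theory Num.Theory.
Local Open Scope ring_scope.
Local Open Scope quotient_scope.

Section Eisenstein.
Variable R : realType.

Definition omega : R[i] := Complex (- 2^-1) (Num.sqrt 3 / 2).
Definition theta : R[i] := omega - omega^*.

Definition eisenstein : {pred R[i]} :=
  [pred z | `[< exists a b : int, z = a%:~R + b%:~R * omega >]].

Lemma eisP z :
  reflect (exists a b : int, z = a%:~R + b%:~R * omega) (z \in eisenstein).
Proof. by rewrite inE; apply: asboolP. Qed.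

Lemma omega_sq : omega * omega = - 1 - omega.
Proof.
have h : (Num.sqrt 3 : R) * Num.sqrt 3 = 3 by rewrite -expr2 sqr_sqrtr.
rewrite /omega; apply/eqP; rewrite eq_complex /=; apply/andP; split; apply/eqP.
  have -> : Num.sqrt 3 / 2 * (Num.sqrt 3 / 2) = (Num.sqrt 3 * Num.sqrt 3) / 4 :> R.
    by field.
  by rewrite h; field.
by field.
Qed.

Lemma conj_omega : omega^* = - 1 - omega.
Proof.
rewrite /omega; apply/eqP; rewrite eq_complex /=; apply/andP; split; apply/eqP.
  by field.
by rewrite oppr0 add0r.
Qed.

Lemma thetaE : theta = 1 + omega *+ 2.
Proof. by rewrite /theta conj_omega; ring. Qed.

Lemma theta_sq : theta * theta = - 3.
Proof.
rewrite thetaE.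
have -> : (1 + omega *+ 2) * (1 + omega *+ 2)
  = 1 + omega *+ 4 + (omega * omega) *+ 4 by ring.
by rewrite omega_sq; ring.
Qed.

Lemma theta_neq0 : theta != 0.
Proof.
apply/eqP => h; have := theta_sq; rewrite h mul0r => /eqP.
by rewrite eq_sym oppr_eq0 pnatr_eq0.
Qed.

Lemma conj_theta : theta^* = - theta.
Proof. by rewrite /theta rmorphB /= conjCK opprB. Qed.

Lemma eisenstein_subring : subring_closed eisenstein.
Proof.
split.
- by apply/eisP; exists 1, 0; rewrite mul0r addr0.
- move=> x y /eisP[a [b ->]] /eisP[c [d ->]]; apply/eisP.
  by exists (a - c), (b - d); rewrite !intrB; ring.
- move=> x y /eisP[a [b ->]] /eisP[c [d ->]]; apply/eisP.
  exists (a * c - b * d), (a * d + b * c - b * d).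
  rewrite !(intrB, intrD, intrM).
  transitivity (a%:~R * c%:~R + (a%:~R * d%:~R + b%:~R * c%:~R) * omega
    + b%:~R * d%:~R * (omega * omega)); first by ring.
  by rewrite omega_sq; ring.
Qed.

HB.instance Definition _ :=
  GRing.isSubringClosed.Build R[i] eisenstein eisenstein_subring.

Lemma conj_eis z : z \in eisenstein -> z^* \in eisenstein.
Proof.
move=> /eisP[a [b ->]]; apply/eisP; exists (a - b), (- b).
by rewrite rmorphD rmorphM /= !rmorph_int conj_omega intrB rmorphN /=; ring.
Qed.

Lemma omega_eis : omega \in eisenstein.
Proof. by apply/eisP; exists 0, 1; rewrite add0r mul1r. Qed.

Lemma theta_eis : theta \in eisenstein.
Proof. by rewrite rpredB ?conj_eis ?omega_eis. Qed.

Record eis := Eis { eisval : R[i]; _ : eisval \in eisenstein }.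
HB.instance Definition _ := [isSub for eisval].
HB.instance Definition _ := [Choice of eis by <:].
HB.instance Definition _ := [SubChoice_isSubComNzRing of eis by <:].

Lemma eisvalP (a : eis) : eisval a \in eisenstein. Proof. by case: a. Qed.

Definition eis_unit (a : eis) : Prop := exists b : eis, a * b = 1.

Definition eis_congr (m x y : R[i]) : Prop :=
  exists2 e, e \in eisenstein & x - y = m * e.

(* Conjugate-linear in the first variable, linear in the second. *)
Definition gram_form n (G : 'M[R[i]]_n) (x y : 'rV[R[i]]_n) : R[i] :=
  \sum_i \sum_j (x 0 i)^* * G i j * y 0 j.

Lemma gram_formDZ n (G : 'M[R[i]]_n) x a y z :
  gram_form G x (a *: y + z) = a * gram_form G x y + gram_form G x z.
Proof.
rewrite /gram_form mulr_sumr -big_split; apply: eq_bigr => i _ /=.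
rewrite mulr_sumr -big_split; apply: eq_bigr => j _ /=.
by rewrite !mxE; ring.
Qed.

Lemma gram_form_conj n (G : 'M[R[i]]_n) x y :
  (forall i j, G j i = (G i j)^*) -> gram_form G y x = (gram_form G x y)^*.
Proof.
move=> hG; rewrite /gram_form exchange_big rmorph_sum; apply: eq_bigr => i _.
rewrite rmorph_sum; apply: eq_bigr => j _ /=.
by rewrite !rmorphM /= conjCK -hG; ring.
Qed.

Lemma gram_form1 n (x y : 'rV[R[i]]_n) :
  gram_form 1%:M x y = \sum_i (x 0 i)^* * y 0 i.
Proof.
apply: eq_bigr => i _; rewrite (bigD1 i) //= mxE eqxx mulr1 big1 ?addr0 //.
by move=> j ji; rewrite mxE eq_sym (negPf ji) mulr0 mul0r.
Qed.

(* Freeness and finite rank are not required here, so that v^perp / <v> is an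
   instance for every v. *)
Record herm_module := HermModule {
  hm_carrier :> lmodType eis;
  hform : hm_carrier -> hm_carrier -> R[i];
  hform_eis : forall x y, hform x y \in eisenstein;
  hformDZ : forall x (a : eis) y z,
    hform x (a *: y + z) = val a * hform x y + hform x z;
  hform_conj : forall x y, hform y x = (hform x y)^* }.

Definition hnorm (M : herm_module) (v : M) : R[i] := hform v v.

Definition isometry (M N : herm_module) (f : M -> N) : Prop :=
  [/\ linear f, bijective f & forall x y, hform (f x) (f y) = hform x y].

Definition isometric (M N : herm_module) : Prop :=
  exists f : M -> N, isometry f.

Definition Aut (M : herm_module) : set (M -> M) := [set f | isometry f].

Inductive generated (T : Type) (S : set (T -> T)) : set (T -> T) :=
| gen_in f : S f -> generated S f
| gen_id : generated S id
| gen_comp f g : generated S f -> generated S g -> generated S (f \o g)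
| gen_inv f g : generated S f -> cancel f g -> cancel g f -> generated S g.

Definition finite_index (T : Type) (H G : set (T -> T)) : Prop :=
  [/\ (H `<=` G)%classic &
   exists (n : nat) (c : 'I_n -> T -> T), (forall i, G (c i)) /\
     forall g, G g -> exists i h, H h /\ g = c i \o h].

Section Gram.
Variables (n : nat) (G : 'M[int]_n) (symG : G^T = G).

Definition gram_hform (x y : 'rV[eis]_n) : R[i] :=
  gram_form (map_mx intr G) (map_mx val x) (map_mx val y).

Lemma gram_hform_eis x y : gram_hform x y \in eisenstein.
Proof.
apply: rpred_sum => i _; apply: rpred_sum => j _.
by rewrite !mxE !rpredM ?conj_eis ?eisvalP // rpred_int.
Qed.

Lemma gram_hformDZ x (a : eis) y z :
  gram_hform x (a *: y + z) = val a * gram_hform x y + gram_hform x z.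
Proof.
rewrite -gram_formDZ; congr gram_form.
by apply/matrixP => i j; rewrite !mxE.
Qed.

Lemma gram_hform_conj x y : gram_hform y x = (gram_hform x y)^*.
Proof.
apply: gram_form_conj => i j; rewrite !mxE rmorph_int; congr (_%:~R).
by rewrite -[in LHS]symG mxE.
Qed.

Definition gram_lattice : herm_module :=
  HermModule gram_hform_eis gram_hformDZ gram_hform_conj.
End Gram.

Definition eis_lattice n : herm_module :=
  gram_lattice (trmx1 int n : (1%:M : 'M[int]_n)^T = 1%:M).

Definition lorentz_gram : 'M[int]_8 :=
  diag_mx (\row_(i < 8) if (i < 7)%N then 1 else -1).
Definition I71 : herm_module :=
  gram_lattice (tr_diag_mx _ : lorentz_gram^T = lorentz_gram).

Definition hyp_gram : 'M[int]_2 := \matrix_(i, j) (i != j)%:R.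
Lemma hyp_gram_sym : hyp_gram^T = hyp_gram.
Proof. by apply/matrixP => i j; rewrite !mxE eq_sym. Qed.
Definition II11 : herm_module := gram_lattice hyp_gram_sym.

Section DirectSum.
Variables M N : herm_module.

Definition osum_hform (x y : (M * N)%type) : R[i] :=
  hform x.1 y.1 + hform x.2 y.2.

Lemma osum_hform_eis x y : osum_hform x y \in eisenstein.
Proof. by rewrite rpredD ?hform_eis. Qed.

Lemma osum_hformDZ x (a : eis) y z :
  osum_hform x (a *: y + z) = val a * osum_hform x y + osum_hform x z.
Proof. by rewrite /osum_hform /= !hformDZ mulrDr addrACA. Qed.

Lemma osum_hform_conj x y : osum_hform y x = (osum_hform x y)^*.
Proof. by rewrite /osum_hform rmorphD /= -!hform_conj. Qed.

Definition osum : herm_module :=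
  HermModule osum_hform_eis osum_hformDZ osum_hform_conj.
End DirectSum.

Section PerpQuotient.
Variables (M : herm_module) (v : M).

Lemma hform0 (x : M) : hform x 0 = 0.
Proof.
have := hformDZ x 1 0 0; rewrite scale1r addr0 rmorph1 mul1r.
by rewrite -[LHS]addr0 => /addrI ->.
Qed.

Lemma hformD (x y z : M) : hform x (y + z) = hform x y + hform x z.
Proof. by rewrite -[y in LHS]scale1r hformDZ rmorph1 mul1r. Qed.

Lemma hformZ (x : M) a (y : M) : hform x (a *: y) = val a * hform x y.
Proof. by rewrite -[a *: y]addr0 hformDZ hform0 addr0. Qed.

Definition perp_pred : {pred M} := [pred x | hform v x == 0].

Lemma perp_submod : submod_closed perp_pred.
Proof.
split=> [|a x y]; rewrite !inE ?hform0 // => /eqP hx /eqP hy.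
by rewrite hformDZ hx hy mulr0 addr0.
Qed.

HB.instance Definition _ :=
  GRing.isSubmodClosed.Build eis M perp_pred perp_submod.

Record perp := Perp { perp_val : M; _ : perp_val \in perp_pred }.
HB.instance Definition _ := [isSub for perp_val].
HB.instance Definition _ := [Choice of perp by <:].
HB.instance Definition _ := [SubChoice_isSubLmodule of perp by <:].

Lemma perp_valP (x : perp) : hform v (val x) = 0.
Proof. by case: x => x /= /eqP. Qed.

(* For isotropic v, these are exactly the elements of <v>. *)
Definition span_pred : {pred perp} :=
  [pred x | `[< exists a : eis, val x = a *: v >]].

Lemma spanP (x : perp) :
  reflect (exists a : eis, val x = a *: v) (x \in span_pred).
Proof. by rewrite inE; apply: asboolP. Qed.

Lemma span_submod : submod_closed span_pred.
Proof.
split=> [|a x y].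
  by apply/spanP; exists 0; rewrite scale0r.
move=> /spanP[b hb] /spanP[c hc]; apply/spanP; exists (a * b + c).
by rewrite linearP /= hb hc scalerDl scalerA.
Qed.

HB.instance Definition _ :=
  GRing.isSubmodClosed.Build eis perp span_pred span_submod.

Definition perp_quot := Quotient.quot (span_pred : zmodClosed perp).
HB.instance Definition _ := GRing.Zmodule.on perp_quot.
HB.instance Definition _ := EqQuotient.on perp_quot.

Lemma perp_quotE (x y : perp) :
  reflect (exists a : eis, val x - val y = a *: v) (x == y %[mod perp_quot]).
Proof.
rewrite -Quotient.idealrBE; apply: (iffP (spanP _)) => -[a ha]; exists a.
  by rewrite -ha raddfB.
by rewrite -ha raddfB.
Qed.

Definition quot_scale (a : eis) (x : perp_quot) : perp_quot :=
  \pi_perp_quot (a *: repr x).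

Lemma pi_scale a (x : perp) :
  quot_scale a (\pi_perp_quot x) = \pi_perp_quot (a *: x).
Proof.
apply/eqP; rewrite -Quotient.idealrBE -scalerBr rpredZ //.
by rewrite Quotient.idealrBE reprK.
Qed.

Lemma pi_addE (x y : perp) :
  \pi_perp_quot (x + y) = \pi_perp_quot x + \pi_perp_quot y.
Proof. exact: (Quotient.pi_add (span_pred : zmodClosed perp)). Qed.

Lemma quot_scaleA a b x : quot_scale a (quot_scale b x) = quot_scale (a * b) x.
Proof. by rewrite -[x]reprK !pi_scale scalerA ?reprK. Qed.

Lemma quot_scale1 : left_id 1 quot_scale.
Proof. by move=> x; rewrite -[x]reprK pi_scale scale1r. Qed.

Lemma quot_scaleDr : right_distributive quot_scale +%R.
Proof.
move=> a x y; rewrite -[x]reprK -[y]reprK -pi_addE !pi_scale scalerDr.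
exact: pi_addE.
Qed.

Lemma quot_scaleDl x : {morph quot_scale^~ x : a b / a + b}.
Proof.
by move=> a b /=; rewrite -[x]reprK !pi_scale scalerDl; exact: pi_addE.
Qed.

HB.instance Definition _ := GRing.Zmodule_isLmodule.Build eis perp_quot
  quot_scaleA quot_scale1 quot_scaleDr quot_scaleDl.

Definition quot_hform (x y : perp_quot) : R[i] :=
  hform (val (repr x)) (val (repr y)).

Lemma hform_perp_eqr (z x y : perp) :
  x == y %[mod perp_quot] -> hform (val z) (val x) = hform (val z) (val y).
Proof.
move=> /perp_quotE[a ha]; rewrite -[val x](subrK (val y)) ha hformD hformZ.
by rewrite hform_conj perp_valP rmorph0 mulr0 add0r.
Qed.

Lemma quot_hform_pi (x y : perp) :
  quot_hform (\pi_perp_quot x) (\pi_perp_quot y) = hform (val x) (val y).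
Proof.
rewrite /quot_hform (@hform_perp_eqr _ _ y) ?reprK //.
by rewrite hform_conj (@hform_perp_eqr _ _ x) ?reprK // -hform_conj.
Qed.

Lemma quot_hform_eis x y : quot_hform x y \in eisenstein.
Proof. exact: hform_eis. Qed.

Lemma quot_hformDZ x (a : eis) y z :
  quot_hform x (a *: y + z) = val a * quot_hform x y + quot_hform x z.
Proof.
rewrite -[x]reprK -[y]reprK -[z]reprK.
rewrite [_ *: _]pi_scale -pi_addE !quot_hform_pi linearP /=.
by rewrite hformDZ.
Qed.

Lemma quot_hform_conj x y : quot_hform y x = (quot_hform x y)^*.
Proof. exact: hform_conj. Qed.

Definition perp_quotient : herm_module :=
  HermModule quot_hform_eis quot_hformDZ quot_hform_conj.
End PerpQuotient.

Definition primitive (M : herm_module) (v : M) : Prop :=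
  v != 0 /\ forall (w : M) (a : eis), v = a *: w -> eis_unit a.

Definition isotropic (M : herm_module) (v : M) : Prop := hnorm v = 0.

(* An alias, since 'rV[R[i]]_6 is already canonically an lmodType R[i]. *)
Definition cvec6 : Type := 'rV[R[i]]_6.
HB.instance Definition _ := GRing.Zmodule.on cvec6.

Definition cvec6_scale (a : eis) (x : cvec6) : cvec6 :=
  (val a *: (x : 'rV[R[i]]_6) : 'rV[R[i]]_6).
Lemma cvec6_scaleA a b x : cvec6_scale a (cvec6_scale b x) = cvec6_scale (a * b) x.
Proof. by rewrite /cvec6_scale scalerA rmorphM. Qed.
Lemma cvec6_scale1 : left_id 1 cvec6_scale.
Proof. by move=> x; rewrite /cvec6_scale rmorph1 scale1r. Qed.
Lemma cvec6_scaleDr : right_distributive cvec6_scale +%R.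
Proof. by move=> a x y; rewrite /cvec6_scale scalerDr. Qed.
Lemma cvec6_scaleDl x : {morph cvec6_scale^~ x : a b / a + b}.
Proof. by move=> a b; rewrite /cvec6_scale rmorphD scalerDl. Qed.
HB.instance Definition _ := GRing.Zmodule_isLmodule.Build eis cvec6
  cvec6_scaleA cvec6_scale1 cvec6_scaleDr cvec6_scaleDl.

(* The numerators: Lambda6 is the set of theta^-1 y for such y. *)
Definition ct_integral (y : 'rV[R[i]]_6) : Prop :=
  [/\ forall i, y 0 i \in eisenstein,
      forall i j, eis_congr theta (y 0 i) (y 0 j)
    & eis_congr 3 (\sum_i y 0 i) 0].

Definition ct_pred : {pred cvec6} :=
  [pred x | `[< exists2 y, ct_integral y & x = theta^-1 *: y >]].

Lemma ctP (x : cvec6) :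
  reflect (exists2 y, ct_integral y & x = theta^-1 *: y) (x \in ct_pred).
Proof. by rewrite inE; apply: asboolP. Qed.

Lemma ct_submod : submod_closed ct_pred.
Proof.
split=> [|a x x'].
  apply/ctP; exists 0; last by rewrite scaler0.
  split=> [i|i j|]; rewrite ?mxE ?rpred0 //.
    by exists 0; rewrite ?rpred0 // mulr0 subrr.
  exists 0; rewrite ?rpred0 // subr0 mulr0 big1 // => i _.
  by rewrite mxE.
move=> /ctP[y [hy1 hy2 [f ff hf]] ->] /ctP[z [hz1 hz2 [g gg hg]] ->].
apply/ctP; exists (val a *: y + z); last first.
  rewrite scalerDr; congr (_ + _).
  by rewrite [LHS]scalerA scalerA mulrC.
split=> [i|i j|].
- by rewrite !mxE rpredD ?rpredM ?hy1 ?hz1 ?eisvalP.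
- have [d dd hd] := hy2 i j; have [e ee he] := hz2 i j.
  exists (val a * d + e); first by rewrite rpredD ?rpredM ?eisvalP.
  rewrite !mxE mulrDr -he mulrCA -hd; ring.
- exists (val a * f + g); first by rewrite rpredD ?rpredM ?eisvalP.
  rewrite mulrDr mulrCA -hf -hg !subr0 mulr_sumr -big_split.
  by apply: eq_bigr => i _; rewrite !mxE.
Qed.

HB.instance Definition _ :=
  GRing.isSubmodClosed.Build eis cvec6 ct_pred ct_submod.

Record coxeter_todd := CoxeterTodd { ctval : cvec6; _ : ctval \in ct_pred }.
HB.instance Definition _ := [isSub for ctval].
HB.instance Definition _ := [Choice of coxeter_todd by <:].
HB.instance Definition _ := [SubChoice_isSubLmodule of coxeter_todd by <:].

Definition ct_hform (x y : coxeter_todd) : R[i] :=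
  \sum_i (ctval x 0 i)^* * ctval y 0 i.

Lemma ct_hform_eis x y : ct_hform x y \in eisenstein.
Proof.
case: x y => [x xP] [y yP]; rewrite /ct_hform /=.
have /ctP[u [hu1 hu2 [f ff hf]] ->] := xP.
have /ctP[w [hw1 hw2 [g gg hg]] ->] := yP.
pose h i : R[i] := (u 0 i - u 0 0) / theta.
pose k i : R[i] := (w 0 i - w 0 0) / theta.
have uE i : u 0 i = u 0 0 + theta * h i.
  by rewrite mulrC divfK ?theta_neq0 // addrC subrK.
have wE i : w 0 i = w 0 0 + theta * k i.
  by rewrite mulrC divfK ?theta_neq0 // addrC subrK.
have hh i : h i \in eisenstein.
  by have [e ee he] := hu2 i 0; rewrite /h he mulrC mulKf ?theta_neq0.
have kk i : k i \in eisenstein.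
  by have [e ee he] := hw2 i 0; rewrite /k he mulrC mulKf ?theta_neq0.
have three : (3 : R[i]) != 0 by rewrite pnatr_eq0.
have sumu : \sum_i u 0 i = 6 * u 0 0 + theta * \sum_i h i.
  rewrite (eq_bigr _ (fun i _ => uE i)) big_split /= sumr_const card_ord.
  by rewrite -mulr_sumr mulr_natl.
have sumh : \sum_i h i = - theta * (f - 2 * u 0 0).
  apply: (mulfI theta_neq0).
  have -> : theta * (- theta * (f - 2 * u 0 0))
    = - (theta * theta) * (f - 2 * u 0 0) by ring.
  rewrite theta_sq opprK mulrBr -hf subr0 sumu; ring.
have -> : \sum_i ((theta^-1 *: u) 0 i)^* * (theta^-1 *: w) 0 i
  = (u 0 0)^* * g + w 0 0 * (f - 2 * u 0 0)^* + \sum_i (h i)^* * k i; last first.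
  rewrite !rpredD ?rpredM ?conj_eis ?rpredB ?rpredM ?rpred_nat //.
  by apply: rpred_sum => i _; rewrite rpredM ?conj_eis.
apply: (mulfI three).
have -> : 3 * (\sum_i ((theta^-1 *: u) 0 i)^* * (theta^-1 *: w) 0 i)
   = \sum_i (u 0 i)^* * w 0 i.
  rewrite mulr_sumr; apply: eq_bigr => i _; rewrite !mxE rmorphM fmorphV /=.
  rewrite conj_theta; apply: (mulfI theta_neq0); apply: (mulfI theta_neq0).
  rewrite [RHS]mulrA theta_sq; field; exact: theta_neq0.
have -> : \sum_i (u 0 i)^* * w 0 i = (u 0 0)^* * \sum_i w 0 i
   - theta * w 0 0 * (\sum_i h i)^* + 3 * (\sum_i (h i)^* * k i).
  rewrite rmorph_sum !mulr_sumr -sumrN -!big_split /=; apply: eq_bigr => i _.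
  rewrite [u 0 i]uE [w 0 i]wE rmorphD rmorphM /= conj_theta.
  have -> : (3 : R[i]) = - (theta * theta) by rewrite theta_sq opprK.
  by ring.
have -> : \sum_i w 0 i = 3 * g by rewrite -hg subr0.
rewrite sumh rmorphM rmorphN /= conj_theta opprK.
have -> : theta * w 0 0 * (theta * (f - 2 * u 0 0)^*)
  = (theta * theta) * w 0 0 * (f - 2 * u 0 0)^* by ring.
by rewrite theta_sq; ring.
Qed.

Lemma ct_hformDZ x (a : eis) y z :
  ct_hform x (a *: y + z) = val a * ct_hform x y + ct_hform x z.
Proof.
rewrite /ct_hform mulr_sumr -big_split; apply: eq_bigr => i _.
have -> : ctval (a *: y + z) =
  (val a *: (ctval y : 'rV[R[i]]_6) + ctval z : 'rV[R[i]]_6) by [].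
by rewrite !mxE mulrDr mulrCA.
Qed.

Lemma ct_hform_conj x y : ct_hform y x = (ct_hform x y)^*.
Proof.
rewrite /ct_hform rmorph_sum; apply: eq_bigr => i _ /=.
by rewrite rmorphM /= conjCK mulrC.
Qed.

Definition Lambda6 : herm_module :=
  HermModule ct_hform_eis ct_hformDZ ct_hform_conj.

Definition L : herm_module := osum Lambda6 II11.

Definition rho : L := (0, delta_mx 0 1).

(* A model of the real tensor product of L: Lambda6 has real rank 12 in C^6, and
   E^2 has real rank 4 in C^2. *)
Definition LR : lmodType R[i] := ('rV[R[i]]_6 * 'rV[R[i]]_2)%type.

Definition LR_form (x y : LR) : R[i] :=
  gram_form 1%:M x.1 y.1 + gram_form (map_mx intr hyp_gram) x.2 y.2.

Definition LR_incl (x : L) : LR := (ctval x.1, map_mx val x.2).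

Lemma LR_form_incl (x y : L) : LR_form (LR_incl x) (LR_incl y) = hform x y.
Proof. by rewrite /LR_form gram_form1. Qed.

(* f is the restriction to L of v |-> v - r (1 - xi) <r|v> / <r|r>, which in
   particular maps L to itself. *)
Definition is_reflection_in (xi : R[i]) (r : LR) (f : L -> L) : Prop :=
  forall v : L, LR_incl (f v) =
    LR_incl v - ((1 - xi) * LR_form r (LR_incl v) / LR_form r r) *: r.

Definition Reflec : set (L -> L) := generated
  [set f | Aut f /\ exists (r : LR) (xi : R[i]) (n : nat),
    [/\ 0 < LR_form r r, (n > 0)%N, n.-unity_root xi, xi != 1
      & is_reflection_in xi r f]].

Definition Reflec0 : set (L -> L) := generated
  [set f | exists (r : L) (xi : eis),
    [/\ hnorm r = 1, eis_unit xi, xi != 1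
      & is_reflection_in (val xi) (LR_incl r) f]].

Definition reflective : Prop := finite_index Reflec (@Aut L).

End Eisenstein.

Arguments Aut {R} M.
Arguments Reflec : clear implicits.
Arguments Reflec0 : clear implicits.

(* Main.v *)
Require Import Defs.
From mathcomp Require Import all_boot all_order all_algebra.
From mathcomp Require Import ring_quotient complex boolp classical_sets reals.
From mathcomp Require Import ring lra zify.

Set Implicit Arguments.
Unset Strict Implicit.
Unset Printing Implicit Defensive.

Import Order.TTheory GRing.Theory Num.Theory.
Local Open Scope ring_scope.

(* L is identified with E^6 + II_(1,1) through an explicit frame [e_0, ..., e_5, p, q].
   Let [v] be primitive isotropic, moved by short reflections so that the height
   [|<p|v>|] is minimal.  If it is not 0, write [l_i = <e_i|v> / <p|v>]; the short
   reflections fixing [p] bring every [l_i] into the third [0, 1/2, d, (1 + omega)/2]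
   of the triangle [0, 1, 1 + omega], where [d = (2 + omega)/3] is a deep hole of E.
   A kite is contained in the disc with diameter [0, d], so [|l_i|^2 <= Re <d|l_i>];
   hence some cusp of height [theta] centred at [d] in three coordinates and at 0
   in the other three lies at squared distance at most 1 from [l], and short
   reflections carry it to a multiple of [p].  Minimality then forces equality, and
   the only survivor is [l = (d, ..., d)], with the central coordinate determined
   up to short reflections.  So up to units there are at most two orbits of cusps
   under the short reflections; that of [p] has quotient E^6, and [rho] lies in the
   other one because the Coxeter-Todd lattice has no vector of norm 1.
   For (ii), an automorphism thus maps [p] to a short reflection image of a unit
   multiple of [p]; after translations it fixes [p] and [q] and permutes the [e_i]
   up to units, so it is a product of reflections in short roots and in norm 2
   vectors. *)

(** * Arithmetic of the Eisenstein integers *)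

Section EisensteinIntegers.
Variable R : realType.
Local Notation C := R[i].
Local Notation om := (omega R).
Local Notation th := (theta R).
Local Notation "x %:C" := (real_complex R x) (format "x %:C").

Definition eis_omega : eis R := Eis (omega_eis R).
Definition eis_theta : eis R := Eis (theta_eis R).
Definition eis_conj (a : eis R) : eis R := Eis (conj_eis (eisvalP a)).

Lemma conjD (x y : C) : (x + y)^* = x^* + y^*. Proof. exact: rmorphD. Qed.
Lemma conjN (x : C) : (- x)^* = - x^*. Proof. exact: rmorphN. Qed.
Lemma conjM (x y : C) : (x * y)^* = x^* * y^*. Proof. exact: rmorphM. Qed.
Lemma conjX (x : C) n : (x ^+ n)^* = x^* ^+ n. Proof. exact: rmorphXn. Qed.
Lemma conj0 : (0 : C)^* = 0. Proof. exact: rmorph0. Qed.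
Lemma conj1 : (1 : C)^* = 1. Proof. exact: rmorph1. Qed.
Lemma conj_int m : (m%:~R : C)^* = m%:~R. Proof. exact: rmorph_int. Qed.

Lemma conj_real (x : R) : (x%:C)^* = x%:C. Proof. exact: conjc_real. Qed.

Lemma realCD (x y : R) : (x + y)%:C = x%:C + y%:C. Proof. exact: rmorphD. Qed.
Lemma realCN (x : R) : (- x)%:C = - x%:C. Proof. exact: rmorphN. Qed.
Lemma realCM (x y : R) : (x * y)%:C = x%:C * y%:C. Proof. exact: rmorphM. Qed.
Lemma realCV (x : R) : x^-1%:C = x%:C^-1. Proof. exact: fmorphV. Qed.
Lemma realC_nat n : (n%:R : R)%:C = n%:R. Proof. exact: rmorph_nat. Qed.
Lemma realC_int m : (m%:~R : R)%:C = m%:~R. Proof. exact: rmorph_int. Qed.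
Lemma realC0 : (0 : R)%:C = 0. Proof. exact: rmorph0. Qed.
Lemma realC1 : (1 : R)%:C = 1. Proof. exact: rmorph1. Qed.

Definition realCE := (realCD, realCN, realCM, realCV, realC_nat, realC_int, realC0, realC1).

Definition conjE := (conjD, conjN, conjM, conjX, conj0, conj1, conj_int,
  @conjCK C, conj_real, conj_omega R, conj_theta R).

Lemma val_eis0 : val (0 : eis R) = 0. Proof. exact: rmorph0. Qed.
Lemma val_eis1 : val (1 : eis R) = 1. Proof. exact: rmorph1. Qed.
Lemma val_eisD (a b : eis R) : val (a + b) = val a + val b. Proof. exact: rmorphD. Qed.
Lemma val_eisN (a : eis R) : val (- a) = - val a. Proof. exact: rmorphN. Qed.
Lemma val_eisM (a b : eis R) : val (a * b) = val a * val b. Proof. exact: rmorphM. Qed.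
Lemma val_eisX (a : eis R) n : val (a ^+ n) = val a ^+ n. Proof. exact: rmorphXn. Qed.
Lemma val_eisMn (a : eis R) n : val (a *+ n) = val a *+ n. Proof. exact: rmorphMn. Qed.
Lemma val_eis_int m : val (m%:~R : eis R) = m%:~R. Proof. exact: rmorph_int. Qed.
Lemma val_eis_conj a : val (eis_conj a) = (val a)^*. Proof. by []. Qed.
Lemma val_eis_omega : val eis_omega = om. Proof. by []. Qed.
Lemma val_eis_theta : val eis_theta = th. Proof. by []. Qed.

Definition val_eisE := (val_eis0, val_eis1, val_eisD, val_eisN, val_eisM,
  val_eisX, val_eisMn, val_eis_int, val_eis_conj, val_eis_omega, val_eis_theta).

Lemma eis_omega_sq : eis_omega * eis_omega = -1 - eis_omega.
Proof. by apply: val_inj; rewrite rmorphM rmorphB rmorphN1 /= omega_sq. Qed.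

Lemma eis_conj_omega : eis_conj eis_omega = -1 - eis_omega.
Proof. by apply: val_inj; rewrite rmorphB rmorphN1 /= conj_omega. Qed.

Lemma eis_thetaE : eis_theta = 1 + eis_omega *+ 2.
Proof. by apply: val_inj; rewrite rmorphD rmorphMn rmorph1 /= thetaE. Qed.

(** A primitive sixth root of unity, hence a generator of the units. *)
Definition eis_six : eis R := - eis_omega.

Lemma eis_six6 : eis_six ^+ 6 = 1.
Proof.
have h3 : eis_six ^+ 3 = -1.
  have -> : eis_six ^+ 3 = - (eis_omega * eis_omega) * eis_omega by rewrite /eis_six; ring.
  rewrite eis_omega_sq; have -> : - (-1 - eis_omega) * eis_omega = eis_omega + eis_omega * eis_omega by ring.
  by rewrite eis_omega_sq; ring.
by rewrite -[6%N]/(3 * 2)%N exprM h3; ring.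
Qed.

(** The squared modulus, kept in [R] so that real inequalities apply to it. *)
Definition cnorm (z : C) : R := complex.Re z ^+ 2 + complex.Im z ^+ 2.

Lemma cnormE z : (cnorm z)%:C = z^* * z :> C.
Proof.
case: z => a b; rewrite /cnorm /=; apply/eqP; rewrite eq_complex /=.
by apply/andP; split; apply/eqP; ring.
Qed.

Lemma cnormM x y : cnorm (x * y) = cnorm x * cnorm y.
Proof. by case: x => a b; case: y => c d; rewrite /cnorm /=; ring. Qed.

Lemma cnorm_conj x : cnorm x^* = cnorm x.
Proof. by case: x => a b; rewrite /cnorm /= sqrrN. Qed.

Lemma cnorm_ge0 x : 0 <= cnorm x.
Proof. by rewrite addr_ge0 ?sqr_ge0. Qed.

Lemma cnorm_eq0 x : (cnorm x == 0) = (x == 0).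
Proof.
by rewrite /cnorm paddr_eq0 ?sqr_ge0 // !sqrf_eq0 eq_complex.
Qed.

Lemma cnorm1 : cnorm 1 = 1.
Proof. by rewrite /cnorm /=; ring. Qed.

Lemma thetaI : th = Complex 0 (Num.sqrt 3).
Proof.
rewrite thetaE /omega; apply/eqP; rewrite eq_complex /=.
by apply/andP; split; apply/eqP; field.
Qed.

Lemma omega_theta : om = - 2^-1 + 2^-1 * th.
Proof.
apply: (@mulfI _ 2); first by rewrite pnatr_eq0.
by rewrite thetaE; field.
Qed.

(** Over the reals, 1 and [theta] are orthogonal; all distance estimates below are made in this
    basis. *)
Lemma cnorm_theta (x y : R) : cnorm (x%:C + y%:C * th) = x ^+ 2 + 3 * y ^+ 2.
Proof.
have h : (Num.sqrt 3 : R) ^+ 2 = 3 by rewrite sqr_sqrtr.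
by rewrite thetaI; move: (Num.sqrt 3) h => s h; rewrite /cnorm /= -h; ring.
Qed.

Lemma complex_theta (z : C) : exists x y : R, z = x%:C + y%:C * th.
Proof.
case: z => a b; exists a, (b / Num.sqrt 3).
have h : (Num.sqrt 3 : R) != 0 by rewrite sqrtr_eq0 -ltNge.
rewrite thetaI; apply/eqP; rewrite eq_complex /=.
by apply/andP; split; apply/eqP; field.
Qed.

Lemma eis_coord (a : eis R) : exists m n : int, a = m%:~R + n%:~R * eis_omega.
Proof.
have /eisP[m [n h]] := eisvalP a; exists m, n; apply: val_inj.
by rewrite rmorphD rmorphM !rmorph_int.
Qed.

Lemma cnorm_coord (m n : int) :
  cnorm (val (m%:~R + n%:~R * eis_omega)) = (m ^+ 2 - m * n + n ^+ 2)%:~R.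
Proof.
rewrite rmorphD rmorphM !rmorph_int /= omega_theta.
have -> : m%:~R + n%:~R * (- 2^-1 + 2^-1 * th)
  = (m%:~R - n%:~R / 2 : R)%:C + (n%:~R / 2 : R)%:C * th.
  rewrite rmorphB !rmorphM !fmorphV /= !rmorph_int rmorph_nat.
  by field.
by rewrite cnorm_theta rmorphD rmorphB !rmorphXn rmorphM /=; field.
Qed.

(** The norm form [m^2 - m n + n^2] is integral and nonnegative. This discreteness makes the descent
    on heights terminate. *)
Lemma cnorm_eis_nat (a : eis R) : exists n : nat, cnorm (val a) = n%:R.
Proof.
have [m [n ->]] := eis_coord a; rewrite cnorm_coord.
have h : 0 <= m ^+ 2 - m * n + n ^+ 2 by nia.
exists `|(m ^+ 2 - m * n + n ^+ 2)%R|%N.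
by rewrite -[in LHS](gez0_abs h).
Qed.

(** The norms of [u] and of its inverse are natural numbers with product 1. *)
Lemma cnorm_unit (u : eis R) : eis_unit u -> cnorm (val u) = 1.
Proof.
move=> [w hw]; have [m hm] := cnorm_eis_nat u; have [n hn] := cnorm_eis_nat w.
have : cnorm (val u) * cnorm (val w) = 1 by rewrite -cnormM -rmorphM hw rmorph1 cnorm1.
rewrite hm hn -natrM => /eqP; rewrite (eqr_nat R _ 1) muln_eq1.
by case/andP => /eqP -> _.
Qed.

Lemma conj_cnorm1 (u : eis R) : cnorm (val u) = 1 -> eis_conj u * u = 1.
Proof. by move=> h; apply: val_inj; rewrite rmorphM /= -cnormE h. Qed.

(** The equation [m^2 - m n + n^2 = 1] forces both coordinates into [{-1, 0, 1}], and its six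
    solutions are the powers of [- omega]. *)
Lemma cnorm1_eis_six (u : eis R) : cnorm (val u) = 1 -> exists m : nat, u = eis_six ^+ m.
Proof.
have [m [n ->]] := eis_coord u; rewrite cnorm_coord => /eqP.
rewrite (eqr_int R _ 1) => /eqP h.
have hm : (m == -1) || (m == 0) || (m == 1) by nia.
have hn : (n == -1) || (n == 0) || (n == 1) by nia.
have w2 : eis_six ^+ 2 = - 1 - eis_omega by rewrite -eis_omega_sq /eis_six; ring.
have w3 : eis_six ^+ 3 = -1.
  rewrite exprS w2 /eis_six; transitivity (eis_omega + eis_omega * eis_omega); first by ring.
  by rewrite eis_omega_sq; ring.
have w4 : eis_six ^+ 4 = eis_omega by rewrite exprSr w3 /eis_six; ring.
have w5 : eis_six ^+ 5 = 1 + eis_omega.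
  by rewrite (exprD _ 2 3) w2 w3; ring.
move: hm => /orP[/orP[]|] /eqP em; move: hn => /orP[/orP[]|] /eqP en;
  rewrite em en in h *; try by [].
- by exists 2%N; rewrite w2; ring.
- by exists 3%N; rewrite w3; ring.
- by exists 1%N; rewrite expr1 /eis_six; ring.
- by exists 4%N; rewrite w4; ring.
- by exists 0%N; rewrite expr0; ring.
- by exists 5%N; rewrite w5; ring.
Qed.

Lemma eis_six_unit m : eis_unit (eis_six ^+ m).
Proof. by exists (eis_six ^+ (5 * m)); rewrite -exprD -[(m + _)%N]/(6 * m)%N exprM eis_six6 expr1n. Qed.

Lemma eis_unitM (u w : eis R) : eis_unit u -> eis_unit w -> eis_unit (u * w).
Proof. by move=> [a ha] [b hb]; exists (a * b); rewrite mulrACA ha hb mulr1. Qed.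

Lemma eis_unit_conj (u : eis R) : eis_unit u -> eis_unit (eis_conj u).
Proof. by move=> /cnorm_unit /conj_cnorm1 h; exists u. Qed.

Lemma omega_conjM : om^* * om = 1.
Proof.
by rewrite conj_omega; transitivity (- om - om * om); [ring | rewrite omega_sq; ring].
Qed.

Lemma eis_omega_unit : eis_unit eis_omega.
Proof.
by exists (eis_conj eis_omega); apply: val_inj; rewrite !val_eisE mulrC omega_conjM.
Qed.

End EisensteinIntegers.

(** * Isometries, complex reflections and equivalence under short reflections *)

Section Isometries.
Variables (R : realType) (M : herm_module R).
Implicit Types (x y z v w r : M) (a b c : eis R) (f g : M -> M).
Local Notation om := (omega R).
Local Notation th := (theta R).
Local Notation Om := (eis_omega R).
Local Notation Th := (eis_theta R).

(** The form with values in [eis], so that they can serve as scalars. *)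
Definition hprod x y : eis R := Eis (hform_eis x y).

Lemma val_hprod x y : val (hprod x y) = hform x y. Proof. by []. Qed.

Lemma hformDl x y z : hform (x + y) z = hform x z + hform y z.
Proof. by rewrite hform_conj hformD rmorphD /= -!hform_conj. Qed.

Lemma hformZl a x z : hform (a *: x) z = (val a)^* * hform x z.
Proof. by rewrite hform_conj hformZ rmorphM /= -hform_conj. Qed.

Lemma hform0l z : hform 0 z = 0.
Proof. by rewrite hform_conj hform0 rmorph0. Qed.

Lemma hformN x y : hform x (- y) = - hform x y.
Proof. by rewrite -scaleN1r hformZ rmorphN1 mulN1r. Qed.

Lemma hformNl x y : hform (- x) y = - hform x y.
Proof. by rewrite hform_conj hformN rmorphN /= -hform_conj. Qed.

Lemma hform_sum (I : finType) x (F : I -> M) :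
  hform x (\sum_i F i) = \sum_i hform x (F i).
Proof. by elim/big_rec2: _ => [|i u w _ <-]; rewrite ?hform0 // hformD. Qed.

Lemma hprodDZ x a y z : hprod x (a *: y + z) = a * hprod x y + hprod x z.
Proof. by apply: val_inj; rewrite rmorphD rmorphM /= hformDZ. Qed.

Lemma hformDD x y z w :
  hform (x + y) (z + w) = hform x z + hform x w + (hform y z + hform y w).
Proof. by rewrite hformDl !hformD. Qed.

Lemma isometry_id : Defs.isometry (id : M -> M).
Proof. by split=> //; exists id. Qed.

Lemma isometry_comp f g :
  Defs.isometry f -> Defs.isometry g -> Defs.isometry (f \o g).
Proof.
move=> [lf bf hf] [lg bg hg]; split=> [a x y||x y] /=.
- by rewrite lg lf.
- exact: bij_comp.
- by rewrite hf hg.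
Qed.

Lemma isometry_inv f g :
  Defs.isometry f -> cancel f g -> cancel g f -> Defs.isometry g.
Proof.
move=> [lf bf hf] fg gf; split=> [a x y||x y].
- by apply: (bij_inj bf); rewrite lf !gf.
- by exists f.
- by rewrite -hf !gf.
Qed.

Lemma isometryZ f a x : Defs.isometry f -> f (a *: x) = a *: f x.
Proof.
case=> lf _ _; have h0 : f 0 = 0.
  by have := lf 1 0 0; rewrite !scale1r addr0 -[LHS]addr0 => /addrI <-.
by have := lf a x 0; rewrite !addr0 h0 addr0.
Qed.

Lemma isometryD f x y : Defs.isometry f -> f (x + y) = f x + f y.
Proof. by case=> lf _ _; have := lf 1 x y; rewrite !scale1r. Qed.

Lemma isometry_sum f (I : finType) (F : I -> M) :
  Defs.isometry f -> f (\sum_i F i) = \sum_i f (F i).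
Proof.
move=> hf; elim/big_rec2: _ => [|i u w _ <-]; last exact: isometryD.
by have := isometryZ 0 0 hf; rewrite !scale0r.
Qed.

Lemma generated_isometry (S : set (M -> M)) :
  (forall f, S f -> Defs.isometry f) -> forall f, generated S f -> Defs.isometry f.
Proof.
move=> hS f; elim=> {f} [f /hS||f g _ hf _ hg|f g _ hf fg gf] //.
- exact: isometry_id.
- exact: isometry_comp.
- exact: isometry_inv hf fg gf.
Qed.

Definition crefl c r v : M := v + (c * hprod r v) *: r.

(* The complex reflection condition: for [hform r r = 1] or [2] it is met by
   [c = xi - 1] with [xi = - omega], and by [c = -1]. *)
Definition crefl_cond c r : Prop :=
  val c + (val c)^* + val c * (val c)^* * hform r r = 0.

Lemma crefl_linear c r : linear (crefl c r).
Proof.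
move=> a x y; rewrite /crefl hprodDZ scalerDr scalerA mulrDr scalerDl.
by rewrite mulrCA; exact: addrACA.
Qed.

Lemma hform_crefl c r v x : 
  hform x (crefl c r v) = hform x v + val c * hform r v * hform x r.
Proof. by rewrite /crefl hformD hformZ val_eisM. Qed.

(** The composite changes [v] by a multiple of [r] whose coefficient is [<r|v>] times the left side
    of [crefl_cond]. *)
Lemma creflK c r : crefl_cond c r -> cancel (crefl c r) (crefl (eis_conj c) r).
Proof.
move=> hc v; rewrite {1}/crefl.
have -> : hprod r (crefl c r v) = hprod r v * (1 + c * hprod r r).
  by apply: val_inj; rewrite !val_eisE !val_hprod hform_crefl; ring.
rewrite /crefl -addrA -scalerDl.
suff -> : c * hprod r v + eis_conj c * (hprod r v * (1 + c * hprod r r)) = 0.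
  by rewrite scale0r addr0.
apply: val_inj; rewrite !val_eisE !val_hprod.
transitivity (hform r v * (val c + (val c)^* + val c * (val c)^* * hform r r)).
  by ring.
by rewrite hc mulr0.
Qed.

Lemma crefl_isometry c r : crefl_cond c r -> Defs.isometry (crefl c r).
Proof.
move=> hc; split; first exact: crefl_linear.
  exists (crefl (eis_conj c) r); first exact: creflK.
  have hc' : crefl_cond (eis_conj c) r.
    by rewrite /crefl_cond val_eis_conj conjCK -[RHS]hc; ring.
  have := creflK hc'; rewrite (_ : eis_conj (eis_conj c) = c) //.
  by apply: val_inj; rewrite !val_eis_conj conjCK.
move=> x y; rewrite hform_crefl /crefl hformDl hformZl hformDl hformZl val_eisM.
rewrite !conjM val_hprod -hform_conj.
transitivity (hform x y + hform x r * hform r y *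
  (val c + (val c)^* + val c * (val c)^* * hform r r)); last by rewrite hc mulr0 addr0.
by ring.
Qed.

(** Since [omega^* = - omega - 1], this is the [(- omega)]-reflection when [r] has norm 1. *)
Definition short_refl r := crefl (eis_conj Om) r.

Lemma short_cond r : hform r r = 1 -> crefl_cond (eis_conj Om) r.
Proof.
move=> h; rewrite /crefl_cond h !val_eisE !conjE mulr1.
by transitivity (- 1 - om - om * om); [ring|rewrite omega_sq; ring].
Qed.

(** One reflection per root suffices: every unit is a power of [- omega], so the other unit
    reflections are powers of this one. *)
Definition short_group : set (M -> M) :=
  generated [set f | exists2 r : M, hform r r = 1 & f = short_refl r].

Lemma short_group_isometry f : short_group f -> Defs.isometry f.
Proof.
by apply: generated_isometry => g [r hr ->]; apply/crefl_isometry/short_cond.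
Qed.

Lemma short_refl_in r : hform r r = 1 -> short_group (short_refl r).
Proof. by move=> hr; apply: gen_in; exists r. Qed.

Lemma hform_short x r v :
  hform x (short_refl r v) = hform x v + om^* * hform r v * hform x r.
Proof. exact: hform_crefl. Qed.

Lemma generated_inv (S : set (M -> M)) f :
  (forall f, S f -> Defs.isometry f) -> generated S f ->
  exists g, [/\ generated S g, cancel f g & cancel g f].
Proof.
move=> hS hf; have [_ [g fg gf] _] := generated_isometry hS hf.
by exists g; split=> //; apply: gen_inv hf fg gf.
Qed.

Definition sequiv x y : Prop := exists2 g, short_group g & g x = y.

Lemma sequiv_refl x : sequiv x x.
Proof. by exists id => //; apply: gen_id. Qed.

Lemma sequiv_trans y x z : sequiv x y -> sequiv y z -> sequiv x z.
Proof.
by move=> [f hf <-] [g hg <-]; exists (g \o f) => //; apply: gen_comp.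
Qed.

Lemma sequiv_sym x y : sequiv x y -> sequiv y x.
Proof.
move=> [f hf <-]; have [|g [hg fg _]] := generated_inv _ hf; last by exists g.
by move=> h [r hr ->]; apply/crefl_isometry/short_cond.
Qed.

Lemma sequivZ a x y : sequiv x y -> sequiv (a *: x) (a *: y).
Proof.
by move=> [f hf <-]; exists f => //; apply/isometryZ/short_group_isometry.
Qed.

Lemma sequiv_short r x : hform r r = 1 -> sequiv x (short_refl r x).
Proof. by move=> hr; exists (short_refl r) => //; apply: short_refl_in. Qed.

(** The norm is [- omega - omega^*]. *)
Lemma hnorm1_omega (x y : M) : hform x x = 0 -> hform y y = 0 -> hform x y = 1 ->
  hform (y - Om *: x) (y - Om *: x) = 1.
Proof.
move=> hx hy hxy; rewrite -scaleNr hformDD hformZl !hformZ hformZl hx hy.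
rewrite [hform y x]hform_conj hxy !val_eisE !conjE; ring.
Qed.

(* [y - omega x] is a short root whose reflection carries [x] to [omega^* y]. *)
Lemma sequiv_swap x y : hform x x = 0 -> hform y y = 0 -> hform x y = 1 ->
  sequiv x (eis_conj Om *: y).
Proof.
move=> hx hy hxy; have h1 := hnorm1_omega hx hy hxy.
have <- : short_refl (y - Om *: x) x = eis_conj Om *: y; last exact: sequiv_short.
rewrite /short_refl /crefl.
have -> : hprod (y - Om *: x) x = 1.
  apply: val_inj; rewrite val_eis1 val_hprod hformDl hformNl hformZl hx mulr0 subr0.
  by rewrite hform_conj hxy rmorph1.
rewrite mulr1 scalerBr scalerA.
have -> : eis_conj Om * Om = 1.
  rewrite eis_conj_omega; transitivity (- (Om * Om) - Om); first by ring.
  by rewrite eis_omega_sq; ring.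
by rewrite scale1r addrC subrK.
Qed.

(** Rescaling [y] by the conjugate of [u] makes the inner product 1. *)
Lemma sequiv_swap_unit x y (u : eis R) : hform x x = 0 -> hform y y = 0 ->
  hform x y = val u -> eis_unit u ->
  sequiv x ((eis_conj Om * eis_conj u) *: y).
Proof.
move=> hx hy hxy hu; rewrite -scalerA; apply: sequiv_swap => //.
  by rewrite hformZl hformZ hy !mulr0.
by rewrite hformZ hxy val_eis_conj -cnormE cnorm_unit.
Qed.

End Isometries.

(** * Reduction of complex numbers to the kite *)

Section Kite.
Variable R : realType.
Local Notation C := R[i].
Local Notation om := (omega R).
Local Notation th := (theta R).
Local Notation Om := (eis_omega R).
Local Notation six := (eis_six R).
Local Notation "x %:C" := (real_complex R x) (format "x %:C").

(* A third of the fundamental triangle [0, 1, 1 + omega] of the Eisenstein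
   integers; it lies in the disc with diameter from 0 to the deep hole
   [(2 + omega) / 3]. *)
Definition kite (a b : R) : Prop :=
  [/\ 0 <= a, 0 <= b, a *+ 2 + b <= 1 & a + b *+ 2 <= 1].

Definition in_kite (z : C) : Prop :=
  exists a b : R, kite a b /\ z = a%:C + b%:C * (1 + om).

(** The maps [z |-> u z + c], with [u] a unit and [c] in E, can be realised on one coordinate by
    short reflections fixing [p]. *)
Definition to_kite (z : C) : Prop :=
  exists (m : nat) (c : eis R), in_kite (val six ^+ m * z + val c).

Lemma to_kite_affine z m (c : eis R) : to_kite (val six ^+ m * z + val c) -> to_kite z.
Proof.
move=> [n [d hd]]; exists (n + m)%N, (six ^+ n * c + d).
by rewrite exprD !val_eisE addrA -mulrA -mulrDr.
Qed.

Lemma val_six3 : val six ^+ 3 = -1.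
Proof.
rewrite /eis_six val_eisE val_eis_omega.
transitivity (- (om * om) * om); first by ring.
rewrite omega_sq; transitivity (om + om * om); first by ring.
by rewrite omega_sq; ring.
Qed.

Lemma val_six4 : val six ^+ 4 = om.
Proof. by rewrite exprSr val_six3 /eis_six !val_eisE; ring. Qed.

(** The rotation [z |-> omega z + 1] about the centroid permutes the barycentric coordinates
    [1 - a - b], [a], [b] cyclically. The kite is the part where the one at the vertex 0 is
    largest. *)
Lemma to_kite_triangle (a b : R) : 0 <= a -> 0 <= b -> a + b <= 1 ->
  to_kite (a%:C + b%:C * (1 + om)).
Proof.
have hk (x y : R) : kite x y -> to_kite (x%:C + y%:C * (1 + om)).
  by move=> h; exists 0%N, 0; rewrite expr0 mul1r val_eis0 addr0; exists x, y.
have hr (x y : R) : to_kite ((1 - x - y)%:C + x%:C * (1 + om)) ->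
    to_kite (x%:C + y%:C * (1 + om)).
  move=> h; apply: (@to_kite_affine _ 4 1); rewrite val_six4 val_eis1.
  suff -> : om * (x%:C + y%:C * (1 + om)) + 1 = (1 - x - y)%:C + x%:C * (1 + om) by [].
  rewrite !rmorphB rmorph1 /=.
  transitivity (om * x%:C + y%:C * om + y%:C * (om * om) + 1); first by ring.
  by rewrite omega_sq; ring.
move=> a0 b0 ab.
have [h1|h1] := lerP (a *+ 2 + b) 1; have [h2|h2] := lerP (a + b *+ 2) 1.
- by apply: hk.
- by apply: hr; apply: hk; split; lra.
- by apply/hr/hr/hk; split; lra.
- have [h3|h3] := lerP a b.
    by apply: hr; apply: hk; split; lra.
  by apply/hr/hr/hk; split; lra.
Qed.

Lemma to_kiteT z : to_kite z.
Proof.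
have [x [y ->]] := complex_theta z.
(* These are the coordinates in the basis [1, 1 + omega]; subtracting floors moves the point into
   the unit parallelogram. *)
pose a := x - y; pose b := y *+ 2.
pose c : eis R := - ((Num.floor a)%:~R + (Num.floor b)%:~R * (1 + Om)).
apply: (@to_kite_affine _ 0 c).
pose a' := a - (Num.floor a)%:~R; pose b' := b - (Num.floor b)%:~R.
have -> : val six ^+ 0 * (x%:C + y%:C * th) + val c = a'%:C + b'%:C * (1 + om).
  rewrite expr0 mul1r /c /a' /b' /a /b !val_eisE !rmorphB rmorphMn /= !rmorph_int thetaE.
  by ring.
have ha := floor_itv a; have hb := floor_itv b; rewrite !intrD in ha hb.
have {ha} ha : 0 <= a' < 1 by rewrite /a'; lra.
have {hb} hb : 0 <= b' < 1 by rewrite /b'; lra.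
have [h|h] := lerP (a' + b') 1; first by apply: to_kite_triangle; lra.
(* The half turn [z |-> 2 + omega - z] exchanges the two triangles of the parallelogram. *)
apply: (@to_kite_affine _ 3 (1 + (1 + Om))).
have -> : val six ^+ 3 * (a'%:C + b'%:C * (1 + om)) + val (1 + (1 + Om))
   = (1 - a')%:C + (1 - b')%:C * (1 + om).
  by rewrite val_six3 !val_eisE !(rmorphB _ 1) rmorph1 /=; ring.
by apply: to_kite_triangle; lra.
Qed.
End Kite.

(** * Frames and the short reflections fixing the cusp [p] *)

(** A decomposition of [M] as E^6 + II_(1,1). The vectors [p] and [q] are dual to each other, which
    is why the coefficient of [p] is the product with [q] and conversely. *)
Record frame (R : realType) (M : herm_module R) (e : 'I_6 -> M) (p q : M) : Prop := Frame {
  frame_ee : forall i j, hform (e i) (e j) = (i == j)%:R;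
  frame_pe : forall i, hform p (e i) = 0;
  frame_qe : forall i, hform q (e i) = 0;
  frame_pp : hform p p = 0;
  frame_qq : hform q q = 0;
  frame_pq : hform p q = 1;
  frame_span : forall x,
    x = \sum_i hprod (e i) x *: e i + (hprod q x *: p + hprod p x *: q) }.

Section FrameTheory.
Variables (R : realType) (M : herm_module R) (e : 'I_6 -> M) (p q : M).
Hypothesis epq : frame e p q.
Implicit Types (x y z v w r : M) (a b c : eis R) (f g : M -> M) (i j : 'I_6) (k : eis R).
Local Notation om := (omega R).
Local Notation th := (theta R).
Local Notation Om := (eis_omega R).
Local Notation Th := (eis_theta R).
Local Notation six := (eis_six R).

Let ee := frame_ee epq.
Let pe := frame_pe epq.
Let qe := frame_qe epq.
Let pp := frame_pp epq.
Let qq := frame_qq epq.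
Let pq := frame_pq epq.

Lemma frame_ep i : hform (e i) p = 0. Proof. by rewrite hform_conj pe conj0. Qed.
Lemma frame_eq i : hform (e i) q = 0. Proof. by rewrite hform_conj qe conj0. Qed.
Lemma frame_qp : hform q p = 1. Proof. by rewrite hform_conj pq conj1. Qed.
Let ep := frame_ep.
Let eq := frame_eq.
Let qp := frame_qp.

Lemma frame_ext x y : (forall i, hform (e i) x = hform (e i) y) ->
  hform p x = hform p y -> hform q x = hform q y -> x = y.
Proof.
move=> h1 h2 h3; rewrite [x](frame_span epq) [y](frame_span epq).
congr (_ + (_ *: _ + _ *: _)); try exact: val_inj.
by apply: eq_bigr => i _; congr (_ *: _); apply: val_inj; apply: h1.
Qed.

Lemma frame_form x y : hform x y = \sum_i (hform (e i) x)^* * hform (e i) y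
  + ((hform p x)^* * hform q y + (hform q x)^* * hform p y).
Proof.
rewrite {1}[y](frame_span epq) !hformD hform_sum !hformZ !val_hprod.
rewrite (hform_conj p x) (hform_conj q x); congr (_ + _).
  by apply: eq_bigr => i _; rewrite hformZ mulrC (hform_conj (e i) x).
by congr (_ + _); rewrite mulrC.
Qed.

Lemma frame_sum_e (c : 'I_6 -> eis R) j : hform (e j) (\sum_i c i *: e i) = val (c j).
Proof.
rewrite hform_sum (bigD1 j) //= big1 ?addr0 => [|i ij].
  by rewrite hformZ ee eqxx mulr1.
by rewrite hformZ ee eq_sym (negPf ij) mulr0.
Qed.

Lemma frame_sum_p (c : 'I_6 -> eis R) : hform p (\sum_i c i *: e i) = 0.
Proof. by rewrite hform_sum big1 // => i _; rewrite hformZ pe mulr0. Qed.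

Lemma frame_sum_q (c : 'I_6 -> eis R) : hform q (\sum_i c i *: e i) = 0.
Proof. by rewrite hform_sum big1 // => i _; rewrite hformZ qe mulr0. Qed.

(** Short roots orthogonal to [p]: their reflections fix [p], preserve [<p|v>] and act affinely on
    the [i]-th coordinate. *)
Definition cusp_root i (k : eis R) : M := e i + k *: p.

Lemma cusp_root1 i k : hform (cusp_root i k) (cusp_root i k) = 1.
Proof.
by rewrite hformDD hformZl !hformZ hformZl ep pe pp ee eqxx !(mulr0, addr0).
Qed.

Lemma cusp_root_form i k v : hform (cusp_root i k) v = hform (e i) v + (val k)^* * hform p v.
Proof. by rewrite hformDl hformZl. Qed.

Lemma cusp_refl_e i k j v : hform (e j) (short_refl (cusp_root i k) v) =
  hform (e j) v + om^* * (hform (e i) v + (val k)^* * hform p v) * (j == i)%:R.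
Proof. by rewrite hform_short cusp_root_form hformD hformZ ep ee mulr0 addr0. Qed.

Lemma cusp_refl_p i k v : hform p (short_refl (cusp_root i k) v) = hform p v.
Proof. by rewrite hform_short hformD hformZ pe pp mulr0 addr0 mulr0 addr0. Qed.

Lemma cusp_refl_q i k v : hform q (short_refl (cusp_root i k) v) =
  hform q v + om^* * (hform (e i) v + (val k)^* * hform p v) * val k.
Proof. by rewrite hform_short cusp_root_form hformD hformZ qe qp mulr1 add0r. Qed.

Lemma cusp_refl_fix i k : short_refl (cusp_root i k) p = p.
Proof.
apply: frame_ext => [j||]; rewrite ?cusp_refl_e ?cusp_refl_p ?cusp_refl_q //.
  by rewrite !ep pp mulr0 addr0 mulr0 mul0r addr0.
by rewrite !ep pp mulr0 addr0 mulr0 mul0r addr0.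
Qed.

Lemma frame_rot i m : exists g, [/\ short_group g, g p = p,
  (forall v j, j != i -> hform (e j) (g v) = hform (e j) v),
  (forall v, hform (e i) (g v) = val six ^+ m * hform (e i) v) &
  (forall v, hform q (g v) = hform q v)].
Proof.
elim: m => [|m [g [hg gp g1 g2 g3]]].
  exists id; split => //; first exact: gen_id.
  by move=> v; rewrite expr0 mul1r.
exists (short_refl (cusp_root i 0) \o g); split => /=.
- by apply: gen_comp hg; apply/short_refl_in/cusp_root1.
- by rewrite gp cusp_refl_fix.
- by move=> v j ji; rewrite cusp_refl_e (negPf ji) mulr0 addr0 g1.
- move=> v; rewrite cusp_refl_e eqxx val_eis0 conj0 mul0r addr0 g2 exprS.
  rewrite mulr1 conj_omega /eis_six val_eisE /=; ring.
- by move=> v; rewrite cusp_refl_q val_eis0 mulr0 addr0.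
Qed.

(** A rotation about 0 is followed by one reflection in a [cusp_root], which supplies the
    translation. *)
Lemma frame_affine i m c : exists g, [/\ short_group g, g p = p,
  (forall v j, j != i -> hform (e j) (g v) = hform (e j) v) &
  (forall v, hform (e i) (g v) = val six ^+ m * hform (e i) v + val c * hform p v)].
Proof.
(* The last reflection contributes one more factor [- omega], and [m + 6] is [m] modulo the order
   6. *)
have [g [hg gp g1 g2 _]] := frame_rot i (m + 5).
have gpv v : hform p (g v) = hform p v.
  by have [_ _ h] := short_group_isometry hg; rewrite -{1}gp h.
exists (short_refl (cusp_root i (eis_conj (Om * c))) \o g); split => /=.
- by apply: gen_comp hg; apply/short_refl_in/cusp_root1.
- by rewrite gp cusp_refl_fix.
- by move=> v j ji; rewrite cusp_refl_e (negPf ji) mulr0 addr0 g1.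
move=> v; rewrite cusp_refl_e eqxx mulr1 g2 gpv val_eis_conj conjCK val_eisM val_eis_omega.
have ow := omega_conjM R.
have s5 : (1 + om^*) * val six ^+ (m + 5) = val six ^+ m.
  have -> : 1 + om^* = val six by rewrite conj_omega /eis_six val_eisE /=; ring.
  rewrite -exprS -[(m + 5).+1]addnS exprD; have := congr1 val (eis_six6 R).
  by rewrite val_eisX val_eis1 => ->; rewrite mulr1.
transitivity ((1 + om^*) * val six ^+ (m + 5) * hform (e i) v + om^* * om * val c * hform p v); first by ring.
by rewrite s5 ow mul1r.
Qed.

(** The coordinates are treated one after another: each [frame_affine] leaves the others and [<p|v>]
    unchanged. *)
Lemma frame_kite v : hform p v != 0 -> exists g, [/\ short_group g, g p = p &
  forall i, in_kite (hform (e i) (g v) / hform p v)].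
Proof.
move=> h0.
have H n : (n <= 6)%N -> exists g, [/\ short_group g, g p = p &
    forall i : 'I_6, (i < n)%N -> in_kite (hform (e i) (g v) / hform p v)].
  elim: n => [|n IH] hn; first by exists id; split => //; apply: gen_id.
  have [g [hg gp g1]] := IH (ltnW hn).
  pose i := Ordinal hn.
  have [m [c hk]] := to_kiteT (hform (e i) (g v) / hform p v).
  have [g' [hg' gp' h1 h2]] := frame_affine i m c.
  exists (g' \o g); split => [||j hj] /=; first exact: gen_comp.
    by rewrite gp gp'.
  have [->|ji] := eqVneq j i.
    rewrite h2; suff -> : hform p (g v) = hform p v.
      by move: hk; congr in_kite; field.
    by have [_ _ h] := short_group_isometry hg; rewrite -{1}gp h.
  rewrite h1 //; apply: g1; rewrite ltn_neqAle -ltnS hj andbT.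
  by apply: contra ji => /eqP hh; apply/eqP/val_inj.
have [g [hg gp hh]] := H 6%N isT; exists g; split => // i; exact: hh.
Qed.

End FrameTheory.

(** * Real inequalities for points of the kite *)

Section DeepHoles.
Variable R : realType.

(** Complementary triples have sums at most [D] and together at least [2 D], so every triple has sum
    [D]; exchanging one index shows that all values agree. *)
Lemma sum_triples (f : 'I_6 -> R) (D : R) :
  (forall i j k, i != j -> i != k -> j != k -> f i + f j + f k <= D) ->
  D *+ 2 <= \sum_i f i -> forall i, f i = D / 3.
Proof.
move=> ht hs.
pose o0 : 'I_6 := @Ordinal 6 0 isT; pose o1 : 'I_6 := @Ordinal 6 1 isT.
pose o2 : 'I_6 := @Ordinal 6 2 isT; pose o3 : 'I_6 := @Ordinal 6 3 isT.
pose o4 : 'I_6 := @Ordinal 6 4 isT; pose o5 : 'I_6 := @Ordinal 6 5 isT.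
have es : \sum_i f i = f o0 + f o1 + f o2 + f o3 + f o4 + f o5.
  rewrite !big_ord_recl big_ord0 addr0 !addrA.
  by congr (f _ + f _ + f _ + f _ + f _ + f _); apply: val_inj.
rewrite es in hs.
have h012 := ht o0 o1 o2 isT isT isT; have h345 := ht o3 o4 o5 isT isT isT.
have h013 := ht o0 o1 o3 isT isT isT; have h245 := ht o2 o4 o5 isT isT isT.
have h014 := ht o0 o1 o4 isT isT isT; have h235 := ht o2 o3 o5 isT isT isT.
have h015 := ht o0 o1 o5 isT isT isT; have h234 := ht o2 o3 o4 isT isT isT.
have h023 := ht o0 o2 o3 isT isT isT; have h145 := ht o1 o4 o5 isT isT isT.
have h123 := ht o1 o2 o3 isT isT isT; have h045 := ht o0 o4 o5 isT isT isT.
have [h0 [h1 [h2 [h3 [h4 h5]]]]] : f o0 = D / 3 /\ f o1 = D / 3 /\ f o2 = D / 3 /\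
    f o3 = D / 3 /\ f o4 = D / 3 /\ f o5 = D / 3.
  by clear ht es; repeat split; lra.
move=> [[|[|[|[|[|[|//]]]]]] hi].
- by rewrite -h0; congr f; apply: val_inj.
- by rewrite -h1; congr f; apply: val_inj.
- by rewrite -h2; congr f; apply: val_inj.
- by rewrite -h3; congr f; apply: val_inj.
- by rewrite -h4; congr f; apply: val_inj.
- by rewrite -h5; congr f; apply: val_inj.
Qed.

Lemma near_int (x : R) : exists a : int, - 2^-1 <= x + a%:~R <= 2^-1.
Proof.
exists (- Num.floor (x + 2^-1)); have := floor_itv (x + 2^-1).
by rewrite intrD rmorphN /=; lra.
Qed.

(** For [z = a + b (1 + omega)] the two sides are [|z|^2] and [Re <d|z>]. Their difference is half
    of [a (1 - 2 a - b) + b (1 - a - 2 b)]. *)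
Lemma kite_le (a b : R) : kite a b -> a ^+ 2 + a * b + b ^+ 2 <= (a + b) / 2.
Proof. by move=> [? ? ? ?]; nra. Qed.

(** Equality makes both nonnegative terms of the difference vanish, which leaves the four vertices
    of the kite. *)
Lemma kite_eq (a b : R) : kite a b -> a ^+ 2 + a * b + b ^+ 2 = (a + b) / 2 ->
  [\/ a = 0 /\ b = 0, a = 2^-1 /\ b = 0, a = 0 /\ b = 2^-1 | a = 3^-1 /\ b = 3^-1].
Proof.
move=> [a0 b0 h1 h2] h.
have e1 : a * (1 - (a *+ 2 + b)) = 0.
  have : 0 <= a * (1 - (a *+ 2 + b)) by rewrite mulr_ge0 ?subr_ge0.
  have : 0 <= b * (1 - (a + b *+ 2)) by rewrite mulr_ge0 ?subr_ge0.
  by move: h; rewrite !expr2; lra.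
have e2 : b * (1 - (a + b *+ 2)) = 0 by move: h e1; rewrite !expr2; lra.
move/eqP: e1; rewrite mulf_eq0 => /orP[] /eqP e1;
  move/eqP: e2; rewrite mulf_eq0 => /orP[] /eqP e2.
- by constructor 1.
- by constructor 3; split => //; lra.
- by constructor 2; split => //; lra.
- by constructor 4; split; lra.
Qed.

(* [|l_i|^2 <= <d|l_i>] for the deep hole [d] of the kite, with equality only at
   its vertices: so one of the twenty cusps with three coordinates at [d] is
   at squared distance at most 1, unless all [l_i] are vertices of the same kind. *)
Lemma irreducible_kites (a b : 'I_6 -> R) (n1 n2 : R) :
  (forall i, kite (a i) (b i)) ->
  \sum_i (a i ^+ 2 + a i * b i + b i ^+ 2) + n1 *+ 2 = 0 ->
  (forall i j k (m : int), i != j -> i != k -> j != k ->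
    1 <= ((b i - a i + (b j - a j) + (b k - a k)) / 2 + 3 * n2 + m%:~R + 2^-1) ^+ 2
      + 3 * (- (a i + b i + (a j + b j) + (a k + b k)) / 2 - n1 + 2^-1) ^+ 2) ->
  [\/ n1 = 0 /\ forall i, a i = 0 /\ b i = 0,
      n1 = - (3 / 4) /\
        forall i, a i = 2^-1 /\ b i = 0 \/ a i = 0 /\ b i = 2^-1 |
      [/\ n1 = -1, forall i, a i = 3^-1 /\ b i = 3^-1
        & exists m : int, 3 * n2 = m%:~R]].
Proof.
move=> hk hn hred.
pose N i := a i ^+ 2 + a i * b i + b i ^+ 2; pose s i := a i + b i.
pose D := \sum_i N i.
have eD : n1 = - (D / 2) by move: hn; rewrite -/D; lra.
have N0 i : 0 <= N i.
  by have [a0 b0 _ _] := hk i; rewrite /N !addr_ge0 ?mulr_ge0 ?exprn_ge0.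
have Ns i : N i <= s i / 2 by apply: kite_le.
(* [N i - s i + 3^-1] is the squared distance to the deep hole [d]. *)
have Nt i : s i - 3^-1 <= N i.
  rewrite /N /s; have : 0 <= (a i - b i) ^+ 2 by apply: sqr_ge0.
  have : 0 <= (a i + b i - 2 / 3) ^+ 2 by apply: sqr_ge0.
  by rewrite !expr2; lra.
have triple i j k : i != j -> i != k -> j != k -> s i + s j + s k <= D.
  move=> ij ik jk.
  have hD : N i + N j + N k <= D.
    rewrite /D (bigD1 i) //= (bigD1 j) ?(eq_sym j) //= (bigD1 k) /=; last first.
      by rewrite ![k == _]eq_sym ik jk.
    by rewrite !addrA lerDl sumr_ge0.
  pose X := (b i - a i + (b j - a j) + (b k - a k)) / 2 + 3 * n2 + 2^-1.
  (* With [m] chosen so that [|X + m| <= 1/2], the reduction hypothesis gives [3 Y^2 >= 3/4]. As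
     [Y >= 0], this means [Y >= 1/2], the bound on the triple. *)
  have [m hm] := near_int X.
  have := hred i j k m ij ik jk.
  set Y := (- _ / 2 - n1 + 2^-1); rewrite [_ + m%:~R + _]addrAC -/X => hXY.
  have eY : Y = (1 + D - (s i + s j + s k)) / 2 by rewrite /Y /s eD; field.
  have hX : (X + m%:~R) ^+ 2 <= 4^-1 by rewrite expr2; nra.
  have Y0 : 0 <= Y by have := Nt i; have := Nt j; have := Nt k; rewrite eY; lra.
  have : 2^-1 <= Y by move: hXY hX; rewrite !expr2; nra.
  by rewrite eY; lra.
have sN : D *+ 2 <= \sum_i s i.
  rewrite mulr2n -[leLHS]big_split /= ler_sum // => i _.
  by have := Ns i; lra.
have hs := sum_triples triple sN.
have eN i : N i = s i / 2.
  apply/eqP; rewrite -subr_eq0 -oppr_eq0 opprB; apply/eqP.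
  have : \sum_i (s i / 2 - N i) = 0.
    rewrite big_split /= sumrN -mulr_suml -/D (eq_bigr _ (fun i _ => hs i)).
    by rewrite sumr_const card_ord; field.
  move/eqP; rewrite psumr_eq0 => [/allP h|j _]; last by rewrite subr_ge0.
  by apply/eqP; apply: (h i); rewrite mem_index_enum.
have hi i := kite_eq (hk i) (eN i).
have ei i : a i + b i = D / 3 by apply: hs.
(* The common value of [a i + b i] is 0, [1/2] or [2/3], so one vertex determines the kind of all
   the others. *)
case: (hi ord0) => -[a0 b0]; have := ei ord0; rewrite a0 b0 => hD.
- apply: Or31; split; first by rewrite eD; lra.
  by move=> i; have := ei i; case: (hi i) => -[-> ->]; lra.
- apply: Or32; split; first by rewrite eD; lra.
  by move=> i; have := ei i; case: (hi i) => -[-> ->]; lra.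
- apply: Or32; split; first by rewrite eD; lra.
  by move=> i; have := ei i; case: (hi i) => -[-> ->]; lra.
have e3 i : a i = 3^-1 /\ b i = 3^-1.
  by have := ei i; case: (hi i) => -[-> ->]; lra.
apply: Or33; split => //; first by rewrite eD; lra.
pose o1 : 'I_6 := @Ordinal 6 1 isT; pose o2 : 'I_6 := @Ordinal 6 2 isT.
have fl := floor_itv (3 * n2); rewrite intrD in fl.
exists (Num.floor (3 * n2)).
(* At deep holes the second square contributes [3/4], so the first bracket has modulus at least
   [1/2]. This shift puts it in [[-1/2, 1/2)], hence at [-1/2]. *)
have := hred ord0 o1 o2 (- Num.floor (3 * n2) - 1) isT isT isT.
have [-> ->] := e3 ord0; have [-> ->] := e3 o1; have [-> ->] := e3 o2.
have -> : n1 = -1 by rewrite eD; lra.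
rewrite intrB rmorphN /=; move: fl; set m := (Num.floor _)%:~R => fl.
rewrite !expr2 => h; nra.
Qed.
End DeepHoles.

(** * Isotropic vectors of minimal height *)

Section Descent.
Variables (R : realType) (M : herm_module R) (e : 'I_6 -> M) (p q : M).
Hypothesis epq : frame e p q.
Implicit Types (x y z v w r : M) (c : eis R) (f g : M -> M) (i j k : 'I_6).
Local Notation om := (omega R).
Local Notation th := (theta R).
Local Notation Om := (eis_omega R).
Local Notation Th := (eis_theta R).
Local Notation six := (eis_six R).
Local Notation "x %:C" := (real_complex R x) (format "x %:C").

Let ee := frame_ee epq.
Let pe := frame_pe epq.
Let qe := frame_qe epq.
Let pp := frame_pp epq.
Let qq := frame_qq epq.
Let pq := frame_pq epq.
Let ep := frame_ep epq.
Let eq := frame_eq epq.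
Let qp := frame_qp epq.

Definition coordE := (pp, qq, pq, qp, pe, qe, ep, eq, ee).

(* Composing the [- omega]-reflections in [e_i] and [e_i - p] rotates the [i]-th
   coordinate about a deep hole; the central coordinate picks up a shift. *)
Lemma sequiv_raise i x : hform (e i) x = om -> hform p x = th -> sequiv x (x + p).
Proof.
move=> hi hp.
have -> : x + p = short_refl (cusp_root e p i (-1)) (short_refl (cusp_root e p i 0) x).
  apply: (frame_ext epq) => [j||].
  - rewrite !(cusp_refl_e epq, cusp_refl_p epq) hformD ep hi hp eqxx !val_eisE !conjE thetaE.
    rewrite addr0 mulr1 mul0r addr0 -!addrA -mulrDl -[LHS]addr0; congr (_ + _).
    suff -> : (-1 - om) * om + (-1 - om) * (om + ((-1 - om) * om + -1 * (1 + om *+ 2))) = 0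
      by rewrite mul0r.
    transitivity ((om * om + om + 1) * (1 + om) ); first by ring.
    by rewrite omega_sq; ring.
  - by rewrite !(cusp_refl_p epq) hformD pp addr0.
  - rewrite !(cusp_refl_q epq, cusp_refl_p epq, cusp_refl_e epq) hformD qp hi hp eqxx !val_eisE !conjE thetaE.
    rewrite mulr0 addr0 -addrA; congr (_ + _); rewrite mulr1 mul0r addr0.
    transitivity (1 + (om * om + om + 1) * (-om -2)); last by ring.
    by rewrite omega_sq; ring.
apply: (@sequiv_trans _ _ (short_refl (cusp_root e p i 0) x)); apply/sequiv_short/(cusp_root1 epq).
Qed.

Lemma sequiv_raise_int i x (m : int) : hform (e i) x = om -> hform p x = th ->
  sequiv x (x + m%:~R *: p).
Proof.
have H (n : nat) y : hform (e i) y = om -> hform p y = th -> sequiv y (y + n%:R *: p).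
  elim: n y => [|n IH] y hi hp; first by rewrite scale0r addr0; apply: sequiv_refl.
  apply: sequiv_trans (IH _ hi hp) _; rewrite -natr1 scalerDl scale1r addrA.
  by apply: (@sequiv_raise i); rewrite hformD hformZ ?ep ?pp mulr0 addr0.
move=> hi hp; case: m => n; first exact: H.
rewrite NegzE; apply: sequiv_sym.
have {2}-> : x = x + (- n.+1%:Z)%:~R *: p + n.+1%:R *: p.
  by rewrite -addrA -scalerDl rmorphN /= addNr scale0r addr0.
by apply: H; rewrite hformD hformZ ?ep ?pp mulr0 addr0.
Qed.

(** For distinct indices, the isotropic vectors of height [theta] centred at [d] in three
    coordinates and at 0 elsewhere, since [omega = theta d]. The integer [m] is free because [theta]
    is purely imaginary. *)
Definition near_cusp i j k (m : int) : M :=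
  Om *: (e i + e j + e k) + Th *: q - Om *: p + m%:~R *: p.

Lemma hform_near_cusp i j k m v : hform (near_cusp i j k m) v =
  om^* * (hform (e i) v + hform (e j) v + hform (e k) v) + th^* * hform q v
  + (m%:~R - om^*) * hform p v.
Proof.
rewrite /near_cusp !hformDl hformNl !hformZl !hformDl !val_eisE conj_int.
by ring.
Qed.

(** For [m = 0] the product with [q] is the unit [- omega], so two swaps lead from [p] through [q]
    to this cusp; [sequiv_raise_int] gives the other [m]. *)
Lemma sequiv_near_cusp i j k m : i != j -> i != k -> j != k ->
  exists2 u : eis R, eis_unit u & sequiv p (u *: near_cusp i j k m).
Proof.
move=> ij ik jk; set w := near_cusp i j k 0.
have wp : hform p w = th.
  by rewrite hform_conj hform_near_cusp !coordE !(mulr0, mulr1, addr0, add0r) conjCK.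
have we : hform (e i) w = om.
  rewrite hform_conj hform_near_cusp !coordE eqxx [j == i]eq_sym [k == i]eq_sym.
  by rewrite (negPf ij) (negPf ik) !(mulr0, mulr1, addr0) conjCK.
have wq : hform q w = - om.
  by rewrite hform_conj hform_near_cusp !coordE !(mulr0, mulr1, addr0, add0r) conjN conjCK.
have wej : hform (e j) w = om.
  rewrite hform_conj hform_near_cusp !coordE eqxx [k == j]eq_sym.
  by rewrite (negPf ij) (negPf jk) !(mulr0, mulr1, addr0, add0r) conjCK.
have wek : hform (e k) w = om.
  rewrite hform_conj hform_near_cusp !coordE eqxx.
  by rewrite (negPf ik) (negPf jk) !(mulr0, mulr1, addr0, add0r) conjCK.
have ww : hform w w = 0.
  rewrite hform_near_cusp wp we wej wek wq !conjE thetaE.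
  transitivity (om * om + om + 1); first by ring.
  by rewrite omega_sq; ring.
have su : eis_unit six by rewrite -[six]expr1; apply: eis_six_unit.
have qw : sequiv q ((eis_conj Om * eis_conj six) *: w).
  by apply: sequiv_swap_unit => //; rewrite wq val_eisN.
have uo := eis_omega_unit R.
exists (eis_conj Om * (eis_conj Om * eis_conj six)).
  by do !apply: eis_unitM => //; apply: eis_unit_conj.
rewrite -scalerA; apply: sequiv_trans (sequiv_swap pp qq pq) _.
apply: sequivZ; apply: sequiv_trans qw _; apply: sequivZ.
have -> : near_cusp i j k m = w + m%:~R *: p by rewrite /w /near_cusp scale0r addr0.
exact: (sequiv_raise_int (i := i)).
Qed.

Definition height v : R := cnorm (hform p v).
Definition height_minimal v : Prop :=
  forall g, short_group g -> height v <= height (g v).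

(** A short reflection product taking [u w] to [p] gives [v] an image of height [|<w|v>|^2]. *)
Lemma height_minimalP v w (u : eis R) : height_minimal v -> eis_unit u ->
  sequiv p (u *: w) -> height v <= cnorm (hform w v).
Proof.
move=> hv hu /sequiv_sym[g hg gw].
have := hv g hg; rewrite /height -gw; have [_ _ ->] := short_group_isometry hg.
by rewrite hformZl cnormM cnorm_conj cnorm_unit // mul1r.
Qed.

(** Heights are norms of Eisenstein integers, hence natural numbers. *)
Lemma exists_height_minimal v : exists2 g, short_group g & height_minimal (g v).
Proof.
pose P n := `[< exists2 g, short_group g & height (g v) = n%:R >].
have hP : exists n, P n.
  have [n hn] := cnorm_eis_nat (hprod p v).
  by exists n; apply/asboolP; exists id => //; apply: gen_id.
have [n /asboolP[g hg gn] hmin] := ex_minnP hP.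
exists g => // g' hg'; have [m hm] := cnorm_eis_nat (hprod p (g' (g v))).
rewrite gn /height -val_hprod hm ler_nat; apply: hmin; apply/asboolP.
by exists (g' \o g) => //; apply: gen_comp.
Qed.

(** The isotropic vectors of height [theta] centred at [d] in all six coordinates. *)
Definition deep_cusp (m : int) : M :=
  \sum_i Om *: e i + Th *: q + (m%:~R - Th) *: p.

(** With height 0 the norm is the sum of the [|<e_i|v>|^2], so only a multiple of [p] remains. *)
Lemma isotropic_height0 v : isotropic v -> primitive v -> hform p v = 0 ->
  exists2 u : eis R, eis_unit u & v = u *: p.
Proof.
move=> hv [v0 prim] hp.
have he i : hform (e i) v = 0.
  have := hv; rewrite /isotropic /hnorm (frame_form epq) hp conj0 mul0r mulr0 !addr0.
  under eq_bigr do rewrite -cnormE.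
  rewrite -rmorph_sum /= => /(congr1 (@complex.Re R)) /= /eqP.
  rewrite psumr_eq0 => [/allP h|j _]; last exact: cnorm_ge0.
  by apply/eqP; rewrite -cnorm_eq0; apply: h; rewrite mem_index_enum.
have ev : v = hprod q v *: p.
  by apply: (frame_ext epq) => [i||]; rewrite hformZ ?coordE ?mulr0 ?mulr1 ?he ?hp.
by exists (hprod q v) => //; apply: prim ev.
Qed.

Lemma height_minimal_adjacent v w : height_minimal v ->
  hform w w = 0 -> hform p w = 1 -> height v <= cnorm (hform w v).
Proof.
move=> hv ww pw; apply: (height_minimalP hv (eis_unit_conj (eis_omega_unit R))).
exact: sequiv_swap.
Qed.

(** Minimality against [near_cusp] leaves the three cases of [irreducible_kites]; in the first two a
    cusp of height 1 is too close, so only the deep holes survive. *)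
Lemma height_minimal_deep v : isotropic v -> primitive v -> height_minimal v ->
  hform p v != 0 -> (forall i, in_kite (hform (e i) v / hform p v)) ->
  exists (u : eis R) (m : int), eis_unit u /\ v = u *: deep_cusp m.
Proof.
move=> iso prim hmin h0; set h := hform p v in h0 * => hk.
have /choice[ab hab] i : exists ab : R * R, kite ab.1 ab.2 /\
    hform (e i) v = h * (ab.1%:C + ab.2%:C * (1 + om)).
  have [a [b [hk1 hk2]]] := hk i; exists (a, b); split => //=.
  by rewrite -hk2; field.
pose a i := (ab i).1; pose b i := (ab i).2.
have xE i : hform (e i) v = h * ((a i)%:C + (b i)%:C * (1 + om)).
  by have [_ ->] := hab i.
have [n1 [n2 nE]] := complex_theta (hform q v / h).
have {}nE : hform q v = h * (n1%:C + n2%:C * th) by rewrite -nE; field.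
have ch : 0 < cnorm h by rewrite lt0r cnorm_eq0 h0 cnorm_ge0.
have xt (x y : R) : x%:C + y%:C * (1 + om) = (x + y / 2)%:C + (y / 2)%:C * th.
  by rewrite omega_theta rmorphD rmorphM fmorphV rmorph_nat; field.
(* Minimality says that the squared distance, scaled by [h], is at least 1. *)
have red w X Y : hform w v = h * (X%:C + Y%:C * th) ->
    cnorm h <= cnorm (hform w v) -> 1 <= X ^+ 2 + 3 * Y ^+ 2.
  by move=> ->; rewrite cnormM cnorm_theta -[leLHS]mulr1 ler_pM2l.
have t3 : th * th + 3 = 0 by rewrite theta_sq addNr.
have := @irreducible_kites R a b n1 n2; case.
- by move=> i; have [] := hab i.
- have := iso; rewrite /isotropic /hnorm (frame_form epq) -/h.
  under eq_bigr do rewrite -cnormE xE cnormM xt cnorm_theta.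
  rewrite -rmorph_sum -mulr_sumr nE /=.
  have -> : \sum_i ((a i + b i / 2) ^+ 2 + 3 * (b i / 2) ^+ 2) =
      \sum_i (a i ^+ 2 + a i * b i + b i ^+ 2) by apply: eq_bigr => i _; field.
  set S := \sum_i _ => hh.
  have {hh} : (cnorm h)%:C * ((S + n1 *+ 2)%:C) = 0.
    have -> : (S + n1 *+ 2)%:C = S%:C + n1%:C *+ 2 by rewrite rmorphD rmorphMn.
    rewrite -[RHS]hh rmorphM /= mulrDr; congr (_ + _).
    rewrite cnormE !conjM conjD conjM !conj_real conj_theta; ring.
  by rewrite -rmorphM => /(congr1 (@complex.Re R)) /= /eqP; rewrite mulf_eq0 (gt_eqF ch) => /eqP.
- move=> i j k m ij ik jk; apply: (red (near_cusp i j k m)).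
    rewrite hform_near_cusp !xE nE -/h conj_theta conj_omega omega_theta.
    rewrite !realCE.
    transitivity (h * (((b i)%:C - (a i)%:C + ((b j)%:C - (a j)%:C) + ((b k)%:C - (a k)%:C)) / 2
      + 3 * n2%:C + m%:~R + 2^-1
      + (- ((a i)%:C + (b i)%:C + ((a j)%:C + (b j)%:C) + ((a k)%:C + (b k)%:C)) / 2
         - n1%:C + 2^-1) * th)
      - h * (th * th + 3) * (((b i)%:C + (b j)%:C + (b k)%:C) / 4 + n2%:C)); first by field.
    by rewrite t3 mulr0 mul0r subr0.
  have [u hu huw] := sequiv_near_cusp m ij ik jk.
  exact: height_minimalP hmin hu huw.
(* All [l_i] are 0: a cusp of height 1 over 0 gives the value [3 (n2 + m)^2 <= 3/4]. *)
- move=> [n10 _]; have [m hm] := near_int n2.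
  have : 1 <= (0 : R) ^+ 2 + 3 * (n2 + m%:~R) ^+ 2; last by rewrite !expr2; nra.
  apply: (red (q - (m%:~R * Th) *: p)).
    rewrite hformDl hformNl hformZl nE n10 -/h !val_eisE !conjE.
    by rewrite !realCE; ring.
  apply: height_minimal_adjacent => //.
    by rewrite !(hformDl, hformNl, hformD, hformN, hformZl, hformZ) !coordE !val_eisE !conjE; ring.
  by rewrite !(hformD, hformN, hformZ) !coordE; ring.
(* All [l_i] are edge midpoints. According to the parity of [k], a cusp over 0 or over a unit in
   coordinate 0 gives at most [9/16 + 3/16 < 1]. *)
- move=> [n1E abE]; have [k hk2] := near_int (n2 * 2).
  have [m [hm|hm]] : exists m : int, k = 2 * m \/ k = 2 * m + 1.
    by exists (k %/ 2)%Z; lia.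
    have : 1 <= (- (3 / 4) : R) ^+ 2 + 3 * (n2 + m%:~R) ^+ 2; last first.
      by rewrite hm intrM in hk2; rewrite !expr2; nra.
    apply: (red (q - (m%:~R * Th) *: p)).
      rewrite hformDl hformNl hformZl nE n1E -/h !val_eisE !conjE.
      by rewrite !realCE; field.
    apply: height_minimal_adjacent => //.
      by rewrite !(hformDl, hformNl, hformD, hformN, hformZl, hformZ) !coordE !val_eisE !conjE; ring.
    by rewrite !(hformD, hformN, hformZ) !coordE; ring.
  (* The unit [l] is twice the midpoint [l_0], namely 1 or [1 + omega]. *)
  have [l [hl1 hl2]] : exists l : eis R, eis_conj l * l = 1 /\
      (val l)^* * hform (e ord0) v = h / 2.
    have [[a0 b0]|[a0 b0]] := abE ord0.
      exists 1; rewrite mulr1; split; first by apply: val_inj; rewrite !val_eisE conj1.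
      by rewrite xE a0 b0 val_eis1 conj1 !realCE; field.
    have hu : (1 + om^*) * (1 + om) = 1.
      by transitivity (1 + om + om^* + om^* * om); [ring | rewrite omega_conjM conj_omega; ring].
    exists (1 + Om); split; first by apply: val_inj; rewrite !val_eisE conjD conj1.
    rewrite xE a0 b0 !val_eisE conjD conj1 !realCE.
    transitivity (h / 2 * ((1 + om^*) * (1 + om))); first by field.
    by rewrite hu mulr1.
  have {}hl1 : (val l)^* * val l = 1 by rewrite -val_eis_conj -val_eisM hl1 val_eis1.
  have : 1 <= (- (3 / 4) : R) ^+ 2 + 3 * (n2 + 2^-1 + m%:~R) ^+ 2; last first.
    by rewrite hm intrD intrM in hk2; rewrite !expr2; nra.
  apply: (red (l *: e ord0 + q + (- 1 - Om - m%:~R * Th) *: p)).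
    rewrite !hformDl !hformZl hl2 nE n1E -/h !val_eisE !conjE omega_theta.
    by rewrite !realCE; field.
  apply: height_minimal_adjacent => //.
    rewrite !(hformDl, hformD, hformZl, hformZ) !coordE eqxx mulr1n !val_eisE !conjE.
    transitivity ((val l)^* * val l - 1); last by rewrite hl1 subrr.
    by ring.
  by rewrite !(hformD, hformZ) !coordE; ring.
- move=> [n1E abE [m mE]].
  have x0 i : hform (e i) v = h * ((2 + om) / 3).
    by rewrite xE; have [-> ->] := abE i; rewrite !realCE; field.
  have thom : th * (2 + om) / 3 = om.
    rewrite thetaE; transitivity ((2 + om * 5 + 2 * (om * om)) / 3); first by field.
    by rewrite omega_sq; field.
  (* Since [<e_0|v> = h d] and [theta d = omega], this is [h / theta], now visibly an Eisenstein
     integer. *)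
  pose u := eis_conj Om * hprod (e ord0) v.
  have hu : val u * th = h.
    rewrite /u !val_eisE val_hprod x0.
    transitivity (h * om^* * (th * (2 + om) / 3)); first by field.
    by rewrite thom -mulrA omega_conjM mulr1.
  clearbody u.
  have ev : v = u *: deep_cusp (- m).
    apply: (frame_ext epq) => [i||].
    + rewrite hformZ /deep_cusp !hformD (frame_sum_e epq (fun=> Om)) !hformZ !coordE x0 -hu.
      by rewrite !mulr0 !addr0 val_eis_omega -[in RHS]thom; field.
    + rewrite hformZ /deep_cusp !hformD (frame_sum_p epq (fun=> Om)) !hformZ !coordE.
      by rewrite mulr0 mulr1 addr0 add0r hu.
    + rewrite hformZ /deep_cusp !hformD (frame_sum_q epq (fun=> Om)) !hformZ !coordE nE -hu n1E.
      have -> : n2%:C = m%:~R / 3.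
        by have -> : n2 = m%:~R / 3 by [rewrite -mE; field]; rewrite !realCE.
      rewrite !val_eisE !realCE mulrNz.
      transitivity (val u * (- th + m%:~R * (th * th + 3) / 3 - m%:~R)); first by field.
      by rewrite t3; ring.
  exists u, (- m); split => //; have [_ hp] := prim; exact: hp ev.
Qed.
End Descent.

(** * Transport of cusps and frames along isometries *)

Section Transport.
Variables (R : realType) (M : herm_module R).
Implicit Types (x y v : M) (f : M -> M).

Lemma primitive_isometry f v : Defs.isometry f -> primitive v -> primitive (f v).
Proof.
move=> hf [v0 hv]; have [lf [g fg gf] hfh] := hf.
have hg := isometry_inv hf fg gf.
split=> [|w a hw].
  apply: contra v0 => /eqP h; rewrite -[v]fg h.
  by have := isometryZ 0 0 hg; rewrite !scale0r => ->.
by apply: (hv (g w)); rewrite -(isometryZ _ _ hg) -hw fg.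
Qed.

Lemma isotropic_isometry f v : Defs.isometry f -> isotropic v -> isotropic (f v).
Proof. by case=> _ _ hf; rewrite /isotropic /hnorm hf. Qed.

Lemma frame_isometry (e : 'I_6 -> M) p q f :
  frame e p q -> Defs.isometry f -> frame (f \o e) (f p) (f q).
Proof.
move=> epq hf; have [lf [g fg gf] hfh] := hf.
have hE x y : hprod (f x) (f y) = hprod x y by apply: val_inj; apply: hfh.
split=> [i j|i|i||||x] /=; rewrite ?hfh; try by case: epq.
rewrite -[x]gf !hE {1}[g x](frame_span epq) !(isometryD _ _ hf) isometry_sum //.
rewrite !(isometryZ _ _ hf); congr (_ + _).
by apply: eq_bigr => i _; rewrite (isometryZ _ _ hf) hE.
Qed.

Lemma frame_unit (e : 'I_6 -> M) p q (u : eis R) :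
  frame e p q -> eis_unit u -> frame e (u *: p) (u *: q).
Proof.
move=> epq hu; have uu := cnorm_unit hu.
have cu : (val u)^* * val u = 1 by rewrite -cnormE uu.
have uc : u * eis_conj u = 1 by rewrite mulrC conj_cnorm1.
have hZl a x y : hprod (a *: x) y = eis_conj a * hprod x y.
  by apply: val_inj; rewrite val_eisM /= hformZl.
case: epq => ee pe qe pp qq pq sp.
split=> // [i|i||||x]; rewrite ?hformZl ?hformZ ?pe ?qe ?pp ?qq ?pq ?mulr0 //.
  by rewrite mulr1.
rewrite {1}[x]sp; congr (_ + (_ + _)); rewrite scalerA hZl.
  by rewrite mulrAC [eis_conj u * u]mulrC uc mul1r.
by rewrite mulrAC [eis_conj u * u]mulrC uc mul1r.
Qed.

End Transport.

(** * The quotient at a cusp that belongs to a frame *)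

Section CuspQuotient.
Variables (R : realType) (M : herm_module R) (e : 'I_6 -> M) (p q : M).
Hypothesis epq : frame e p q.

(** The coordinates along the [e_i] do not see multiples of [p], and on the complement of [p] they
    carry the whole form. *)
Lemma perp_quotient_frame : isometric (perp_quotient p) (eis_lattice R 6).
Proof.
pose c (x : M) : 'rV[eis R]_6 := \row_i hprod (e i) x.
have cp (x y : perp p) : (x == y %[mod perp_quot p])%qT -> c (val x) = c (val y).
  move=> /perp_quotE[a ha]; apply/rowP => i; rewrite !mxE; apply: val_inj => /=.
  by rewrite -[val x](subrK (val y)) ha hformD hformZ (frame_ep epq) mulr0 add0r.
pose F (x : perp_quotient p) : eis_lattice R 6 := c (val (repr (x : perp_quot p))).
have Fpi (x : perp p) : F (\pi_(perp_quot p) x)%qT = c (val x).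
  by apply: cp; rewrite reprK.
have hc (x y : M) : hform p x = 0 -> hform p y = 0 ->
    @hform R (eis_lattice R 6) (c x) (c y) = hform x y.
  move=> hx hy; rewrite (frame_form epq) hx hy conj0 mul0r mulr0 !addr0.
  rewrite /= /gram_hform map_mx1 gram_form1.
  by apply: eq_bigr => i _; rewrite !mxE.
have pin (y : 'rV[eis R]_6) : \sum_i y 0 i *: e i \in perp_pred p.
  by apply/eqP; apply: (frame_sum_p epq (fun i => y 0 i)).
exists F; split.
- move=> a x y; rewrite -[x]reprK -[y]reprK.
  have -> : a *: (\pi_(perp_quot p) (repr x))%qT + (\pi_(perp_quot p) (repr y))%qT
    = (\pi_(perp_quot p) (a *: repr x + repr y))%qT :> perp_quotient p.
    by rewrite [_ *: _]pi_scale -pi_addE.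
  rewrite !Fpi; apply/rowP => i; rewrite !mxE; apply: val_inj => /=.
  by rewrite !hformDZ.
- exists (fun y : eis_lattice R 6 => (\pi_(perp_quot p) (Perp (pin y)))%qT : perp_quotient p).
    move=> x; rewrite -[RHS]reprK; apply/eqP/perp_quotE.
    have e0 : hprod p (val (repr x)) = 0.
      by apply: val_inj; rewrite val_hprod perp_valP.
    have := frame_span epq (val (repr x)); rewrite e0 scale0r addr0 => e1.
    exists (- hprod q (val (repr x))); rewrite [X in _ - X]e1 /= scaleNr opprD addrA.
    rewrite -[RHS]add0r; congr (_ - _); apply/eqP; rewrite subr_eq0; apply/eqP.
    by apply: eq_bigr => i _; rewrite mxE.
  move=> y; rewrite Fpi /=; apply/rowP => i; rewrite mxE; apply: val_inj.
  exact: (frame_sum_e epq (fun i => y 0 i)).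
- move=> x y; rewrite /F hc ?perp_valP //.
Qed.

End CuspQuotient.

(** * Orbits of cusps under short reflections *)

Section Cusps.
Variables (R : realType) (M : herm_module R) (e : 'I_6 -> M) (p q : M).
Hypothesis epq : frame e p q.
Implicit Types (x y z v w r : M) (f g : M -> M) (i j k : 'I_6).
Local Notation om := (omega R).
Local Notation th := (theta R).
Local Notation Om := (eis_omega R).
Local Notation Th := (eis_theta R).
Local Notation six := (eis_six R).

Let ee := frame_ee epq.
Let pe := frame_pe epq.
Let qe := frame_qe epq.
Let pp := frame_pp epq.
Let qq := frame_qq epq.
Let pq := frame_pq epq.
Let ep := frame_ep epq.
Let eq := frame_eq epq.
Let qp := frame_qp epq.
Let cE := (pp, qq, pq, qp, pe, qe, ep, eq, ee).

Lemma deep_cusp_sequiv m : sequiv (deep_cusp e p q 0) (deep_cusp e p q m).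
Proof.
have -> : deep_cusp e p q m = deep_cusp e p q 0 + m%:~R *: p.
  by rewrite /deep_cusp -[RHS]addrA -scalerDl mulr0z sub0r [- Th + _]addrC.
apply: (sequiv_raise_int epq (i := ord0)).
  by rewrite /deep_cusp !hformD (frame_sum_e epq (fun=> Om)) !hformZ ep eq !mulr0 !addr0.
rewrite /deep_cusp !hformD (frame_sum_p epq (fun=> Om)) !hformZ pp pq.
by rewrite mulr0 addr0 add0r mulr1.
Qed.

Lemma sequiv_cusp v : isotropic v -> primitive v ->
  exists2 u : eis R, eis_unit u &
    sequiv v (u *: p) \/ sequiv v (u *: deep_cusp e p q 0).
Proof.
move=> iso prim; have [g hg hmin] := exists_height_minimal p v.
have ig := short_group_isometry hg.
have iso1 := isotropic_isometry ig iso; have prim1 := primitive_isometry ig prim.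
have hv : sequiv v (g v) by exists g.
have [h0|h0] := eqVneq (hform p (g v)) 0.
  have [u hu e1] := isotropic_height0 epq iso1 prim1 h0.
  by exists u => //; left; rewrite -e1.
have [g' [hg' gp hk]] := frame_kite epq h0.
have ig' := short_group_isometry hg'.
have hp : hform p (g' (g v)) = hform p (g v).
  by have [_ _ h] := ig'; rewrite -{1}gp h.
(* Fixing [p], the kite reduction [g'] does not change the height, so minimality persists. *)
have hmin' : height_minimal p (g' (g v)).
  move=> k hk1; rewrite /height hp; apply: (hmin (k \o g')).
  exact: gen_comp.
have [||||u [m [hu e1]]] := height_minimal_deep epq _ _ hmin'.
- exact: isotropic_isometry.
- exact: primitive_isometry.
- by rewrite hp.
- by move=> i; rewrite hp.
exists u => //; right; apply: sequiv_trans hv _; apply: (@sequiv_trans _ _ (g' (g v))).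
  by exists g'.
rewrite e1; apply/sequivZ/sequiv_sym/deep_cusp_sequiv.
Qed.

(** Swapping [p] with [q] and back multiplies by [(omega^* )^2 = omega]; a circuit through a third
    cusp [w] gives the sign. Together they give the generator [- omega]. *)
Lemma sequiv_unit u : eis_unit u -> sequiv p (u *: p).
Proof.
move=> /cnorm_unit /cnorm1_eis_six[m ->].
have hs : sequiv p (six *: p).
  have hw : sequiv p (Om *: p).
    apply: sequiv_trans (sequiv_swap pp qq pq) _.
    have -> : Om *: p = eis_conj Om *: (eis_conj Om *: p).
      rewrite scalerA eis_conj_omega; congr (_ *: _).
      transitivity (Om * Om + Om *+ 2 + 1); last by ring.
      by rewrite eis_omega_sq; ring.
    by apply/sequivZ/sequiv_swap.
  have hn : sequiv p (- p).
    pose o1 : 'I_6 := @Ordinal 6 1 isT.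
    pose w := e ord0 + e o1 + p - q.
    have ww : hform w w = 0.
      by rewrite !(hformDl, hformNl, hformD, hformN) !cE /= !mulr1n; ring.
    have pw : hform p w = -1 by rewrite !(hformD, hformN) !cE; ring.
    have qw : hform q w = 1 by rewrite !(hformD, hformN) !cE; ring.
    have un : eis_unit (-1 : eis R) by exists (-1); ring.
    apply: sequiv_trans (sequiv_swap pp qq pq) _.
    have -> : - p = eis_conj Om *: (eis_conj Om *: ((eis_conj Om * eis_conj (-1)) *: p)).
      rewrite !scalerA -scaleN1r; congr (_ *: _).
      have -> : eis_conj (-1 : eis R) = -1 by apply: val_inj; rewrite !val_eisE !conjE.
      rewrite eis_conj_omega.
      transitivity ((1 + Om) * (1 + Om *+ 2 + Om * Om)); last by ring.
      rewrite eis_omega_sq; transitivity (Om + Om * Om); last by ring.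
      by rewrite eis_omega_sq; ring.
    apply/sequivZ/(sequiv_trans (sequiv_swap qq ww qw)); apply: sequivZ.
    apply: sequiv_swap_unit => //.
    by rewrite hform_conj pw val_eisN val_eis1 !conjE.
  apply: sequiv_trans hw _; rewrite /eis_six scaleNr -scalerN; exact: sequivZ.
elim: m => [|m IH]; first by rewrite expr0 scale1r; apply: sequiv_refl.
by apply: sequiv_trans IH _; rewrite exprSr -scalerA; apply: sequivZ.
Qed.

End Cusps.

(** * The stabiliser of a cusp *)

Section CuspStabiliser.
Variables (R : realType) (M : herm_module R) (e : 'I_6 -> M) (p q : M).
Hypothesis epq : frame e p q.
Implicit Types (x y z v w r : M) (f g : M -> M) (i j k : 'I_6).
Local Notation om := (omega R).
Local Notation th := (theta R).
Local Notation Om := (eis_omega R).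
Local Notation Th := (eis_theta R).
Local Notation six := (eis_six R).

Let ee := frame_ee epq.
Let pe := frame_pe epq.
Let qe := frame_qe epq.
Let pp := frame_pp epq.
Let qq := frame_qq epq.
Let pq := frame_pq epq.
Let ep := frame_ep epq.
Let eq := frame_eq epq.
Let qp := frame_qp epq.
Let cE := (pp, qq, pq, qp, pe, qe, ep, eq, ee).

(** The two reflections together rotate one coordinate about 0, so the coordinates of [q] stay 0 and
    only a shift along [p] is left. *)
Lemma central_shift : exists g, [/\ short_group g, g p = p &
  forall c : eis R, g (q + c *: p) = q + (c - Th) *: p].
Proof.
exists (short_refl (cusp_root e p ord0 1) \o short_refl (cusp_root e p ord0 Om)).
split => /=.
- by apply: gen_comp; apply/short_refl_in/(cusp_root1 epq).
- by rewrite !(cusp_refl_fix epq).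
move=> c; apply: (frame_ext epq) => [j||].
- rewrite !(cusp_refl_e epq, cusp_refl_p epq) !(hformD, hformZ) !cE eqxx !val_eisE !conjE.
  rewrite !mulr0 !addr0 !add0r !mulr1 -mulrDl.
  suff -> : (-1 - om) * (-1 - om) + (-1 - om) * ((-1 - om) * (-1 - om) + 1) = 0 by rewrite mul0r.
  transitivity ((om * om + om + 1) * (- 1 - om)); first by ring.
  by rewrite omega_sq; ring.
- by rewrite !(cusp_refl_p epq) !(hformD, hformZ) !cE; ring.
- rewrite !(cusp_refl_q epq, cusp_refl_p epq, cusp_refl_e epq) !(hformD, hformZ) !cE.
  rewrite eqxx !val_eisE !conjE thetaE.
  rewrite !mulr0 !addr0 !add0r !mulr1.
  have -> : (-1 - om) * (-1 - om) = om.
    by transitivity (1 + om *+ 2 + om * om); [ring | rewrite omega_sq; ring].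
  by ring.
Qed.

Lemma central_shift_int (m : int) : exists g, [/\ short_group g, g p = p &
  forall c : eis R, g (q + c *: p) = q + (c - m%:~R * Th) *: p].
Proof.
have H (n : nat) : exists g, [/\ short_group g, g p = p &
    forall c : eis R, g (q + c *: p) = q + (c - n%:R * Th) *: p].
  elim: n => [|n [g [hg gp gc]]].
    by exists id; split => // [|c]; [exact: gen_id | rewrite mul0r subr0].
  have [g' [hg' gp' gc']] := central_shift.
  exists (g' \o g); split => /= [||c]; [exact: gen_comp | by rewrite gp gp' |].
  by rewrite gc gc' -natr1 mulrDl mul1r opprD addrA.
case: m => n; first exact: H.
have [g [hg gp gc]] := H n.+1; have [_ [g' gg' g'g] _] := short_group_isometry hg.
exists g'; split => [||c]; [exact: gen_inv hg gg' g'g | by rewrite -{1}gp gg' |].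
rewrite -[RHS]gg' gc; congr (g' (_ + _ *: _)).
by rewrite NegzE mulrNz mulNr opprK addrK.
Qed.

(** At height 1 the coordinates of [x] lie in E, so translations bring them to 0; central shifts
    then remove the remaining multiple of [p]. *)
Lemma cusp_translate x : hform x x = 0 -> hform p x = 1 ->
  exists g, [/\ short_group g, g p = p & g x = q].
Proof.
move=> xx px.
have H n : (n <= 6)%N -> exists g, [/\ short_group g, g p = p &
    forall i : 'I_6, (i < n)%N -> hform (e i) (g x) = 0].
  elim: n => [|n IH] hn; first by exists id; split => //; apply: gen_id.
  have [g [hg gp g1]] := IH (ltnW hn).
  pose i := Ordinal hn.
  have [g' [hg' gp' h1 h2]] := frame_affine epq i 0 (- hprod (e i) (g x)).
  exists (g' \o g); split => [||j hj] /=; first exact: gen_comp.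
    by rewrite gp gp'.
  have [->|ji] := eqVneq j i.
    have -> : forall y, hform (e i) (g' y) = hform (e i) y - hform (e i) (g x) * hform p y.
      by move=> y; rewrite h2 expr0 mul1r val_eisN mulNr.
    have [_ _ h] := short_group_isometry hg.
    by have -> : hform p (g x) = 1 by [rewrite -{1}gp h]; rewrite mulr1 subrr.
  rewrite h1 //; apply: g1; rewrite ltn_neqAle -ltnS hj andbT.
  by apply: contra ji => /eqP hh; apply/eqP/val_inj.
have {H} [g [hg gp ge]] := H 6%N isT.
have [_ _ hgh] := short_group_isometry hg.
have gpx : hform p (g x) = 1 by rewrite -{1}gp hgh.
pose c := hprod q (g x).
have gx : g x = q + c *: p.
  apply: (frame_ext epq) => [i||]; rewrite !(hformD, hformZ) !cE.
  - by rewrite mulr0 addr0; apply: ge.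
  - by rewrite mulr0 addr0.
  - by rewrite mulr1 add0r.
have cc : val c + (val c)^* = 0.
  have : hform (g x) (g x) = 0 by rewrite hgh.
  by rewrite gx hformDD !(hformZ, hformZl) !cE => <-; ring.
(* A purely imaginary [a + b omega] has [b = 2 a], hence equals [a theta]. *)
have [m cm] : exists m : int, c = m%:~R * Th.
  have [a [b ec]] := eis_coord c.
  move: cc; rewrite ec !val_eisE !conjE => cc.
  have {cc} : ((a *+ 2 - b)%:~R : R[i]) = 0.
    by rewrite -cc intrB rmorphMn /=; ring.
  move/eqP; rewrite intr_eq0 => /eqP eb.
  have {}eb : b = a *+ 2 by lia.
  by exists a; rewrite eb eis_thetaE rmorphMn /=; ring.
have [g' [hg' gp' gc']] := central_shift_int m.
exists (g' \o g); split => /=; [exact: gen_comp | by rewrite gp gp' |].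
by rewrite gx gc' cm subrr scale0r addr0.
Qed.

(** Stands for the generators of [Reflec], through the short reflections and the order 2 reflections
    in norm 2 vectors. *)
Variable S : set (M -> M).
Hypothesis S_isom : forall f, S f -> Defs.isometry f.
Hypothesis S_short : forall r, hform r r = 1 -> generated S (short_refl r).
Hypothesis S_long : forall r, hform r r = 2 -> generated S (crefl (-1) r).

Lemma short_group_sub f : short_group f -> generated S f.
Proof.
elim=> {f} [f [r hr ->]||f g _ hf _ hg|f g _ hf fg gf].
- exact: S_short.
- exact: gen_id.
- exact: gen_comp.
- exact: gen_inv hf fg gf.
Qed.

(** The coordinate norms are natural numbers with sum 1, so exactly one of them is not 0. *)
Lemma norm1_coord x : hform x x = 1 -> hform p x = 0 -> hform q x = 0 ->
  exists j, exists2 u : eis R, cnorm (val u) = 1 & x = u *: e j.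
Proof.
move=> xx px qx.
have hs : \sum_j cnorm (hform (e j) x) = 1.
  have := xx; rewrite (frame_form epq) px qx !mulr0 !addr0.
  under eq_bigr do rewrite -cnormE.
  by rewrite -rmorph_sum /= => /(congr1 (@complex.Re R)).
have [j hj] : exists j, cnorm (hform (e j) x) != 0.
  apply/existsP; rewrite -negb_forall; apply/negP => /forallP h.
  by move/eqP: hs; rewrite big1 ?(eq_sym 0) ?oner_eq0 // => j _; apply/eqP.
have hj1 : 1 <= cnorm (hform (e j) x).
  move: hj; rewrite -val_hprod; have [n ->] := cnorm_eis_nat (hprod (e j) x).
  by rewrite pnatr_eq0 ler1n lt0n.
move: hs; rewrite (bigD1 j) //= => hs.
have h0 : 0 <= \sum_(i | i != j) cnorm (hform (e i) x) by apply: sumr_ge0 => i _; apply: cnorm_ge0.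
have hz : \sum_(i | i != j) cnorm (hform (e i) x) = 0 by lra.
exists j, (hprod (e j) x); first by rewrite val_hprod; lra.
apply: (frame_ext epq) => [i||]; rewrite hformZ !cE ?mulr0 //.
have [->|ij] := eqVneq i j; first by rewrite mulr1.
rewrite mulr0; apply/eqP; rewrite -cnorm_eq0.
by move/eqP: hz; rewrite psumr_eq0 => [/allP/(_ i (mem_index_enum _))|k _]; rewrite ?ij ?cnorm_ge0.
Qed.

(** The images of the [e_i] are sent back one at a time, keeping those already in place: a rotation
    if the image lies on the right axis, a norm 2 reflection otherwise. *)
Lemma stabiliser_monomial f : Defs.isometry f -> f p = p -> f q = q -> generated S f.
Proof.
move=> hf fp fq.
have H n : (n <= 6)%N -> exists g, [/\ generated S g, g p = p, g q = q &
    forall i : 'I_6, (i < n)%N -> g (f (e i)) = e i].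
  elim: n => [|n IH] hn; first by exists id; split => //; apply: gen_id.
  have [g [hg gp gq g1]] := IH (ltnW hn).
  have ig := generated_isometry S_isom hg.
  have [_ _ hI] := isometry_comp ig hf.
  pose k := Ordinal hn; pose x := g (f (e k)).
  have xx : hform x x = 1 by rewrite [LHS]hI ee eqxx.
  have px : hform p x = 0 by rewrite -gp -fp [LHS]hI pe.
  have qx : hform q x = 0 by rewrite -gq -fq [LHS]hI qe.
  have xe i : (i < n)%N -> hform (e i) x = 0.
    by move=> ni; rewrite -(g1 i ni) [LHS]hI ee -val_eqE /= (ltn_eqF ni).
  have [j [u hu xE]] := norm1_coord xx px qx.
  have uu : (val u)^* * val u = 1 by rewrite -cnormE hu.
  suff [g' [hg' g'p g'q g'e g'x]] : exists g', [/\ generated S g', g' p = p, g' q = q,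
      forall i : 'I_6, (i < n)%N -> g' (e i) = e i & g' x = e k].
    exists (g' \o g); split => [|||i] /=; rewrite ?gp ?gq //; first exact: gen_comp.
    rewrite ltnS leq_eqVlt => /orP[/eqP hi|hi]; last by rewrite g1 // g'e.
    by have -> : i = k by apply: val_inj.
  have [jk|jk] := eqVneq j k.
    have [m um] := cnorm1_eis_six hu.
    (* The exponent [5 m] undoes [m], as the units have order dividing 6. *)
    have [g' [hg' g'p h1 h2 h3]] := frame_rot epq k (5 * m).
    have [_ _ h] := short_group_isometry hg'.
    have hp y : hform p (g' y) = hform p y by rewrite -{1}g'p h.
    exists g'; split => //; first exact: short_group_sub.
    + apply: (frame_ext epq) => [i||]; rewrite ?hp ?h3 //.
      have [->|ik] := eqVneq i k; last by rewrite h1.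
      by rewrite h2 eq mulr0.
    + move=> i ni; apply: (frame_ext epq) => [l||]; rewrite ?hp ?h3 //.
      have [->|lk] := eqVneq l k; last by rewrite h1.
      by rewrite h2 ee -val_eqE /= (gtn_eqF ni) mulr0.
    + rewrite xE jk; apply: (frame_ext epq) => [l||]; rewrite ?hp ?h3 ?hformZ ?cE ?mulr0 //.
      have [->|lk] := eqVneq l k; last by rewrite h1 // hformZ ee (negPf lk) mulr0.
      rewrite h2 hformZ ee eqxx mulr1 um -val_eisX -val_eisM -exprD.
      by rewrite -mulSnr exprM eis_six6 expr1n val_eis1.
  have hkx : hform (e k) x = 0 by rewrite xE hformZ ee eq_sym (negPf jk) mulr0.
  have xek : hform x (e k) = 0 by rewrite hform_conj hkx conj0.
  have nj : (n <= j)%N.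
    rewrite leqNgt; apply/negP => /xe; rewrite xE hformZ ee eqxx mulr1 => u0.
    by move: uu; rewrite u0 mulr0 => /eqP; rewrite eq_sym oner_eq0.
  have cr y : hform (x - e k) y = 0 -> crefl (-1) (x - e k) y = y.
    move=> h; rewrite /crefl; have -> : hprod (x - e k) y = 0 by apply: val_inj.
    by rewrite mulr0 scale0r addr0.
  (* This reflection exchanges the orthogonal norm 1 vectors [x] and [e k] and fixes what is
     orthogonal to both. *)
  exists (crefl (-1) (x - e k)); split.
  - apply: S_long; rewrite !(hformDl, hformNl, hformD, hformN) xx ee eqxx hkx xek mulr1n; ring.
  - by apply: cr; rewrite hformDl hformNl ep [hform x p]hform_conj px conj0 subr0.
  - by apply: cr; rewrite hformDl hformNl eq [hform x q]hform_conj qx conj0 subr0.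
  - move=> i ni; apply: cr; rewrite hformDl hformNl [hform x _]hform_conj xe // conj0.
    by rewrite ee -val_eqE /= (gtn_eqF ni) subr0.
  - rewrite /crefl; have -> : hprod (x - e k) x = 1.
      by apply: val_inj; rewrite val_hprod val_eis1 hformDl hformNl xx hkx subr0.
    by rewrite mulr1 scaleN1r opprB addrC subrK.
have [g [hg gp gq ge]] := H 6%N isT.
have ig := generated_isometry S_isom hg.
have gf x : g (f x) = x.
  have igf := isometry_comp ig hf.
  rewrite {1}[x](frame_span epq) -[g (f _)]/((g \o f) _) !(isometryD _ _ igf).
  rewrite (isometry_sum _ igf) !(isometryZ _ _ igf) /= fp fq gp gq.
  rewrite [RHS](frame_span epq); congr (_ + _).
  by apply: eq_bigr => i _; have := isometryZ (hprod (e i) x) (e i) igf; rewrite /= ge.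
have [_ [f' ff' f'f] _] := hf.
have fg : cancel g f by move=> y; rewrite -[y]f'f gf.
exact: gen_inv hg fg gf.
Qed.

(** Short reflections return [f p] to [p], then [f q] to [q]; what remains is monomial. *)
Lemma generated_cusp f u : Defs.isometry f -> eis_unit u -> sequiv (f p) (u *: p) ->
  generated S f.
Proof.
move=> hf hu hs.
have hs' := sequiv_trans hs (sequiv_sym (sequiv_unit epq hu)).
have [g hg gf] := hs'; have ig := short_group_isometry hg.
have [_ _ hgf] := isometry_comp ig hf.
have [|| g' [hg' g'p g'q]] := @cusp_translate (g (f q)).
- by rewrite [LHS]hgf qq.
- by rewrite -{1}gf [LHS]hgf pq.
have hk : generated S (g' \o g) by apply/short_group_sub/gen_comp.
have [k [hk1 k1 k2]] := generated_inv S_isom hk.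
have -> : f = k \o ((g' \o g) \o f).
  by apply: funext => x; rewrite [RHS]k1.
apply: gen_comp hk1 _; apply: stabiliser_monomial.
- by apply: isometry_comp hf; apply: generated_isometry hk.
- by rewrite /= gf g'p.
- by rewrite /= g'q.
Qed.

End CuspStabiliser.

(** * From a frame to the diagonal form of signature (7,1) *)

Section LorentzFrame.
Variables (R : realType) (M : herm_module R) (e : 'I_6 -> M) (p q : M).
Hypothesis epq : frame e p q.
Local Notation om := (omega R).
Local Notation Om := (eis_omega R).

Lemma frame_lorentz : isometric M (I71 R).
Proof.
(* These are orthogonal, of norms [- omega - omega^* = 1] and [omega + omega^* = -1], and span the
   same plane as [p] and [q]. *)
pose b6 := q - Om *: p; pose b7 := q + eis_conj Om *: p.
have h6 x : hform b6 x = hform q x - om^* * hform p x.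
  by rewrite hformDl hformNl hformZl.
have h7 x : hform b7 x = hform q x + om * hform p x.
  by rewrite hformDl hformZl val_eis_conj conjCK.
(* The sign at [b7] compensates its norm -1, so that products with [B] are the coordinates. *)
pose B (k : 'I_(6 + 2)) : M :=
  match split k with inl i => e i | inr j => if j == 0 then b6 else - b7 end.
have Bl i : B (lshift 2 i) = e i by rewrite /B (unsplitK (inl i)).
have Br j : B (rshift 6 j) = if j == 0 then b6 else - b7.
  by rewrite /B (unsplitK (inr j)).
pose F (x : M) : 'rV[eis R]_(6 + 2) := \row_k hprod (B k) x.
pose G (y : 'rV[eis R]_(6 + 2)) : M := \sum_i y 0 (lshift 2 i) *: e i
  + (y 0 (rshift 6 0) *: b6 + y 0 (rshift 6 1) *: b7).
have oo : om + om^* = -1 by rewrite conj_omega; ring.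
have oo1 := omega_conjM R.
exists (F : M -> I71 R); split.
- by move=> a x y; apply/rowP => k; rewrite !mxE hprodDZ.
- exists G.
    move=> x; rewrite /G; under eq_bigr => i _ do rewrite mxE Bl.
    rewrite !mxE !Br /= [RHS](frame_span epq); congr (_ + _).
    rewrite /b6 /b7 !scalerBr !scalerDr !scalerA addrACA -scaleNr -!scalerDl addrC.
    have -> : hprod (- b7) x = - hprod b7 x by apply: val_inj; rewrite val_eisN !val_hprod hformNl.
    congr (_ *: _ + _ *: _); apply: val_inj; rewrite !val_eisE !val_hprod h6 h7.
      transitivity (- (om + om^*) * hform q x); first by ring.
      by rewrite oo; ring.
    transitivity (- (om + om^*) * hform p x); first by ring.
    by rewrite oo; ring.
  move=> y; apply/rowP => k; rewrite mxE; apply: val_inj; rewrite val_hprod.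
  rewrite -[k]splitK; case: (split k) => [i|j]; rewrite [unsplit _]/=.
    rewrite Bl /G /b6 /b7 !hformD (frame_sum_e epq (fun i => y 0 (lshift 2 i))).
    by rewrite !hformZ !(hformD, hformN) !hformZ (frame_ep epq) (frame_eq epq); ring.
  have qG : hform q (G y) = - om * val (y 0 (rshift 6 0)) + om^* * val (y 0 (rshift 6 1)).
    rewrite /G /b6 /b7 !hformD (frame_sum_q epq (fun i => y 0 (lshift 2 i))).
    rewrite !hformZ !(hformD, hformN) !hformZ.
    by rewrite (frame_qq epq) (frame_qp epq) val_eis_conj val_eis_omega; ring.
  have pG : hform p (G y) = val (y 0 (rshift 6 0)) + val (y 0 (rshift 6 1)).
    rewrite /G /b6 /b7 !hformD (frame_sum_p epq (fun i => y 0 (lshift 2 i))).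
    rewrite !hformZ !(hformD, hformN) !hformZ.
    by rewrite (frame_pq epq) (frame_pp epq); ring.
  rewrite Br; have [->|j0] := eqVneq j 0.
    rewrite h6 qG pG; transitivity (- (om + om^*) * val (y 0 (rshift 6 0))); first by ring.
    by rewrite oo; ring.
  have -> : j = 1 by case: j j0 => [[|[|//]]] // h _; apply: val_inj.
  rewrite hformNl h7 qG pG; transitivity (- (om + om^*) * val (y 0 (rshift 6 1))); first by ring.
  by rewrite oo; ring.
- move=> x y; rewrite [RHS](frame_form epq) /= /gram_hform /gram_form.
  have dE (i j : 'I_8) : i != j -> (map_mx intr lorentz_gram : 'M[R[i]]_8) i j = 0.
    by move=> ij; rewrite !mxE (negPf ij) mulr0n.
  have dD (i : 'I_8) : (map_mx intr lorentz_gram : 'M[R[i]]_8) i i = if (i < 7)%N then 1 else -1.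
    by rewrite !mxE eqxx mulr1n; case: ifP.
  rewrite (eq_bigr (fun i : 'I_8 =>
    (if (i < 7)%N then 1 else -1) * ((val (F x 0 i))^* * val (F y 0 i)))); last first.
    move=> i _; rewrite (bigD1 i) //= big1 ?addr0 => [|j ij].
      by rewrite dD !mxE; case: ifP => _; ring.
    by rewrite dE ?mulr0 ?mul0r // eq_sym.
  rewrite (@big_split_ord _ _ _ 6 2) /=; congr (_ + _).
    apply: eq_bigr => i _; rewrite !mxE Bl; case: ifP => [_|/negP[]]; first by rewrite mul1r.
    exact: leq_trans (ltn_ord i) _.
  rewrite big_ord_recl big_ord_recl big_ord0 !mxE !Br /= mul1r mulN1r addr0.
  rewrite !hformNl h6 h7 h6 h7 !(conjD, conjN, conjM) !conjCK.
  transitivity (- (om + om^*) * (hform p x)^* * hform q y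
     - (om + om^*) * (hform q x)^* * hform p y + (om^* * om - om^* * om)); last by rewrite oo; ring.
  by ring.
Qed.

End LorentzFrame.

(** * A frame of the lattice, and the cusp [rho] *)

Section CoxeterTodd.
Variable R : realType.
Local Notation om := (omega R).
Local Notation th := (theta R).
Local Notation Om := (eis_omega R).
Local Notation Th := (eis_theta R).
Implicit Types (x y : L R) (i j k : 'I_6).

Lemma L_form x y : hform x y = \sum_i (ctval x.1 0 i)^* * ctval y.1 0 i
  + ((val (x.2 0 0))^* * val (y.2 0 1) + (val (x.2 0 1))^* * val (y.2 0 0)).
Proof.
rewrite [LHS]/(ct_hform _ _ + gram_hform _ _ _); congr (_ + _).
rewrite /gram_hform /gram_form !big_ord_recl !big_ord0 !mxE /=.
have -> : lift ord0 ord0 = 1 :> 'I_2 by apply: val_inj.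
by rewrite !(mulr0, mul0r, mulr1, addr0, add0r).
Qed.

Lemma LR_inclDZ (a : eis R) x y : LR_incl (a *: x + y) = val a *: LR_incl x + LR_incl y.
Proof.
rewrite /LR_incl; congr (_, _).
by apply/matrixP => i j; rewrite !mxE.
Qed.

Lemma ct_mem (y : 'rV[R[i]]_6) : ct_integral y -> (th^-1 *: y : cvec6 R) \in @ct_pred R.
Proof. by move=> h; apply/ctP; exists y. Qed.

Definition dl i j : R[i] := (i == j)%:R.

Lemma sum_dl (F : 'I_6 -> R[i]) k : \sum_i dl i k * F i = F k.
Proof.
rewrite (bigD1 k) //= big1 ?addr0 => [|i ik]; first by rewrite /dl eqxx mul1r.
by rewrite /dl (negPf ik) mul0r.
Qed.

Lemma sum_dl1 k : \sum_i dl i k = 1.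
Proof. by rewrite -[RHS](sum_dl (fun=> 1) k); apply: eq_bigr => i _; rewrite mulr1. Qed.

Lemma conj_dl i j : (dl i j)^* = dl i j. Proof. exact: conj_int (i == j : nat). Qed.

Lemma dl_eis i j : dl i j \in @eisenstein R. Proof. exact: rpred_nat. Qed.

Definition e_num k : 'rV[R[i]]_6 := \row_i (th * (dl i 0 - dl i k)).
Definition p_num : 'rV[R[i]]_6 := \row_i (3 * dl i 0 - 1).
Definition q_num : 'rV[R[i]]_6 := \row_i (- 3 * dl i 0).

Lemma e_num_ct k : ct_integral (e_num k).
Proof.
split=> [i|i j|]; rewrite ?mxE.
- by rewrite rpredM ?theta_eis ?rpredB ?dl_eis.
- exists (dl i 0 - dl i k - (dl j 0 - dl j k)); rewrite ?rpredB ?dl_eis //.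
  by ring.
- exists 0; rewrite ?rpred0 // subr0 mulr0; under eq_bigr do rewrite mxE.
  by rewrite -mulr_sumr big_split /= sumrN !sum_dl1 subrr mulr0.
Qed.

Lemma p_num_ct : ct_integral p_num.
Proof.
split=> [i|i j|]; rewrite ?mxE.
- by rewrite rpredB ?rpredM ?dl_eis ?rpred_nat ?rpred1.
- exists (- th * (dl i 0 - dl j 0)).
    by rewrite rpredM ?rpredN ?theta_eis ?rpredB ?dl_eis.
  by rewrite mulrA mulrN theta_sq; ring.
- exists (-1); rewrite ?rpredN ?rpred1 // subr0; under eq_bigr do rewrite mxE.
  by rewrite big_split /= sumrN -mulr_sumr sum_dl1 sumr_const card_ord; ring.
Qed.

Lemma q_num_ct : ct_integral q_num.
Proof.
split=> [i|i j|]; rewrite ?mxE.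
- by rewrite rpredM ?dl_eis ?rpredN ?rpred_nat.
- exists (th * (dl i 0 - dl j 0)).
    by rewrite rpredM ?theta_eis ?rpredB ?dl_eis.
  by rewrite mulrA theta_sq; ring.
- exists (-1); rewrite ?rpredN ?rpred1 // subr0; under eq_bigr do rewrite mxE.
  by rewrite -mulr_sumr sum_dl1; ring.
Qed.

Definition hyp_vec (a b : eis R) : II11 R := \row_i (if i == 0 then a else b).

(* The [Le k] are the orthonormal roots [(eps_0 - eps_k; 1, omega^* )], and
   [(0; 1, - omega)] for [k = 0].  Their complement consists of the vectors
   [(theta^-1 y, (theta^-1 y - theta m)^5; theta m, omega^* theta m)], which have
   norm [2 Re ((y + 2m)^* (y + 3m))]; [Lp] and [Lq] are the isotropic ones with
   [(y, m) = (2, -1)] and [(-3, 1)]. *)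
Definition Le k : L R := (CoxeterTodd (ct_mem (e_num_ct k)),
  hyp_vec 1 (if k == 0 then - Om else eis_conj Om)).
Definition Lp : L R := (CoxeterTodd (ct_mem p_num_ct),
  hyp_vec (- Th) (- (eis_conj Om * Th))).
Definition Lq : L R := (CoxeterTodd (ct_mem q_num_ct),
  hyp_vec Th (eis_conj Om * Th)).

Lemma L_ext x y : (forall i, ctval x.1 0 i = ctval y.1 0 i) ->
  val (x.2 0 0) = val (y.2 0 0) -> val (x.2 0 1) = val (y.2 0 1) -> x = y.
Proof.
case: x y => [x1 x2] [y1 y2] /= h1 h2 h3; congr (_, _).
  by apply: val_inj; apply/rowP.
apply/rowP => i; apply: val_inj.
have [->//|i0] := eqVneq i 0.
by have -> : i = 1 by case: i i0 => [[|[|//]]] // h _; apply: val_inj.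
Qed.

Lemma Le_0 k : (Le k).2 0 0 = 1. Proof. by rewrite mxE. Qed.
Lemma Le_1 k : (Le k).2 0 1 = if k == 0 then - Om else eis_conj Om.
Proof. by rewrite mxE. Qed.
Lemma Lp_0 : Lp.2 0 0 = - Th. Proof. by rewrite mxE. Qed.
Lemma Lp_1 : Lp.2 0 1 = - (eis_conj Om * Th). Proof. by rewrite mxE. Qed.
Lemma Lq_0 : Lq.2 0 0 = Th. Proof. by rewrite mxE. Qed.
Lemma Lq_1 : Lq.2 0 1 = eis_conj Om * Th. Proof. by rewrite mxE. Qed.

Lemma ctval_e k i : ctval (Le k).1 0 i = dl i 0 - dl i k.
Proof. by rewrite !mxE mulKf ?theta_neq0. Qed.

Lemma ctval_p i : ctval Lp.1 0 i = th^-1 * (3 * dl i 0 - 1).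
Proof. by rewrite !mxE. Qed.

Lemma ctval_q i : ctval Lq.1 0 i = th * dl i 0.
Proof.
rewrite !mxE; have -> : (-3 : R[i]) = th * th by rewrite theta_sq.
by rewrite -mulrA mulKf ?theta_neq0.
Qed.

Definition L_coordE := (Le_0, Le_1, Lp_0, Lp_1, Lq_0, Lq_1, ctval_e, ctval_p, ctval_q).

Lemma conj3 : (3 : R[i])^* = 3. Proof. exact: (conj_int R 3). Qed.

Lemma Le_form k x : hform (Le k) x = ctval x.1 0 0 - ctval x.1 0 k + val (x.2 0 1)
  + (if k == 0 then - om^* else om) * val (x.2 0 0).
Proof.
rewrite L_form !L_coordE val_eis1 conj1 mul1r addrA; congr (_ + _ + _ * _); last first.
  by case: ifP => _; rewrite ?val_eisN ?conjN // val_eis_conj conjCK.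
rewrite -(sum_dl (fun i => ctval x.1 0 i) 0) -(sum_dl (fun i => ctval x.1 0 i) k).
rewrite -sumrB; apply: eq_bigr => i _.
by rewrite ctval_e conjD conjN !conj_dl mulrBl.
Qed.

Lemma Lp_form x : hform Lp x = - th^-1 * (3 * ctval x.1 0 0 - \sum_i ctval x.1 0 i)
  + th * val (x.2 0 1) + om * th * val (x.2 0 0).
Proof.
rewrite L_form !L_coordE !val_eisE !conjN conjM conjCK conj_theta -addrA.
congr (_ + (_ + _)); rewrite ?opprK //; last by rewrite mulrN opprK.
rewrite -(sum_dl (fun i => ctval x.1 0 i) 0) mulr_sumr -sumrB mulr_sumr.
apply: eq_bigr => i _.
rewrite ctval_p conjM conjD conjN conj1 conjM conj_dl fmorphV /= conj_theta invrN conj3.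
by ring.
Qed.

Lemma Lq_form x : hform Lq x = - th * ctval x.1 0 0
  - th * val (x.2 0 1) - om * th * val (x.2 0 0).
Proof.
rewrite L_form !L_coordE !val_eisE conjM conjCK conj_theta -addrA.
congr (_ + (_ + _)); rewrite ?mulrN ?mulNr //.
rewrite -(sum_dl (fun i => ctval x.1 0 i) 0) mulr_sumr -sumrN; apply: eq_bigr => i _.
by rewrite ctval_q conjM conj_dl conj_theta; ring.
Qed.

Lemma sum_const6 (a : R[i]) : \sum_(i < 6) a = 6 * a.
Proof. by rewrite sumr_const card_ord; ring. Qed.

(** Yields the spanning clause of the frame: a vector minus its expansion is orthogonal to the
    frame. *)
Lemma L_nondegenerate z : (forall k, hform (Le k) z = 0) -> hform Lp z = 0 ->
  hform Lq z = 0 -> z = 0.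
Proof.
move=> he; rewrite Lp_form Lq_form => hp hq.
set m := val (z.2 0 0) in hp hq *; set n := val (z.2 0 1) in hp hq *.
set l := ctval z.1 0 0 in hp hq *.
have nE : n = om^* * m.
  by have := he 0; rewrite Le_form eqxx subrr add0r mulNr => /eqP; rewrite subr_eq0 => /eqP.
have mE : m = l.
  apply: (mulfI (theta_neq0 R)); apply/eqP; rewrite eq_sym -subr_eq0 -oppr_eq0; apply/eqP.
  rewrite -[RHS]hq nE conj_omega; ring.
have lk k : k != 0 -> ctval z.1 0 k = 0.
  move=> k0; have := he k; rewrite Le_form (negPf k0) -/l -/m -/n nE mE conj_omega => hk.
  by apply/eqP; rewrite -oppr_eq0; apply/eqP; rewrite -[RHS]hk; ring.
have l0 : l = 0.
  have sl : \sum_i ctval z.1 0 i = l by rewrite (bigD1 0) //= big1 ?addr0.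
  move: hp; rewrite sl nE mE conj_omega => hp.
  have hh : th * (- th^-1 * (3 * l - l) + th * ((-1 - om) * l) + om * th * l) = 0.
    by rewrite hp mulr0.
  rewrite -[RHS]hh; transitivity (- (2 * l) - (th * th) * l); first by rewrite theta_sq; ring.
  by field; exact: theta_neq0.
have m0 : m = 0 by rewrite mE.
apply: L_ext => [i||].
- rewrite [RHS]mxE; have [->|/lk//] := eqVneq i 0.
  by rewrite -/l.
- by rewrite -/m m0 [in RHS]mxE val_eis0.
- by rewrite -/n nE m0 mulr0 [in RHS]mxE val_eis0.
Qed.

Lemma L_frame : frame Le Lp Lq.
Proof.
have oo : om^* = -1 - om by rewrite conj_omega.
have t3 : th^-1 * 3 = - th.
  by have -> : (3 : R[i]) = - (th * th) by [rewrite theta_sq opprK]; field; exact: theta_neq0.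
have e3 : - th^-1 * 3 = th by rewrite mulNr t3 opprK.
have sume k : \sum_i ctval (Le k).1 0 i = 0.
  by under eq_bigr do rewrite ctval_e; rewrite sumrB !sum_dl1 subrr.
have sump : \sum_i ctval Lp.1 0 i = th.
  under eq_bigr do rewrite ctval_p.
  rewrite -mulr_sumr sumrB -mulr_sumr sum_dl1 sum_const6.
  by transitivity (- (th^-1 * 3)); [ring | rewrite t3 opprK].
have sumq : \sum_i ctval Lq.1 0 i = th.
  by under eq_bigr do rewrite ctval_q; rewrite -mulr_sumr sum_dl1 mulr1.
have d0 k : dl 0 k = dl k 0 by rewrite /dl eq_sym.
have d00 : dl 0 0 = 1 by rewrite /dl eqxx.
have dn k : k != 0 -> dl k 0 = 0 by rewrite /dl => /negPf ->.
have ee i j : hform (Le i) (Le j) = (i == j)%:R.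
  rewrite Le_form !L_coordE d00 -/(dl i j) val_eis1 mulr1.
  have [->|i0] := eqVneq i 0; have [->|j0] := eqVneq j 0;
    rewrite ?d00 ?(d0 j) ?(dn j j0) ?(dn i i0) ?val_eisN ?val_eis_conj ?val_eis_omega ?oo; ring.
have pe i : hform Lp (Le i) = 0.
  rewrite Lp_form sume !L_coordE d00 subr0 mulrA e3 val_eis1 mulr1.
  by have [->|i0] := eqVneq i 0;
    rewrite ?d00 ?(d0 i) ?(dn i i0) ?val_eisN ?val_eis_conj ?val_eis_omega ?oo; ring.
have qe i : hform Lq (Le i) = 0.
  rewrite Lq_form !L_coordE d00 val_eis1 mulr1.
  by have [->|i0] := eqVneq i 0;
    rewrite ?d00 ?(d0 i) ?(dn i i0) ?val_eisN ?val_eis_conj ?val_eis_omega ?oo; ring.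
have pp : hform Lp Lp = 0.
  rewrite Lp_form sump !L_coordE d00 !val_eisE oo.
  transitivity (- (th^-1 * 3) * th^-1 * 2 + th^-1 * th + th * th); first by ring.
  by rewrite t3 opprK theta_sq mulfV ?mulVf ?theta_neq0 //; ring.
have qq : hform Lq Lq = 0.
  by rewrite Lq_form !L_coordE d00 !val_eisE oo; ring.
have pq : hform Lp Lq = 1.
  rewrite Lp_form sumq !L_coordE d00 !val_eisE oo.
  transitivity (- (th^-1 * th) * 2 - th * th); first by ring.
  by rewrite theta_sq mulVf ?theta_neq0 //; ring.
have ep i : hform (Le i) Lp = 0 by rewrite hform_conj pe conj0.
have eq i : hform (Le i) Lq = 0 by rewrite hform_conj qe conj0.
have qp : hform Lq Lp = 1 by rewrite hform_conj pq conj1.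
split=> // x; apply/eqP; rewrite -subr_eq0; apply/eqP; apply: L_nondegenerate => [k||].
- rewrite hformD hformN !hformD !hformZ ep eq !mulr0 !addr0 hform_sum (bigD1 k) // big1.
    by rewrite hformZ ee eqxx mulr1 val_hprod; apply/eqP; rewrite subr_eq0; apply/eqP; rewrite -[LHS]addr0.
  by move=> i ik; rewrite hformZ ee eq_sym (negPf ik) mulr0.
- rewrite hformD hformN !hformD !hformZ pp pq mulr0 mulr1 add0r hform_sum big1 ?add0r ?subrr //.
  by move=> i _; rewrite hformZ pe mulr0.
- rewrite hformD hformN !hformD !hformZ qq qp mulr0 mulr1 addr0 hform_sum big1 ?add0r ?subrr //.
  by move=> i _; rewrite hformZ qe mulr0.
Qed.

(** The numerator would have norm 3, hence a zero among its six coordinates, so all are divisible by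
    [theta]. The quotient has a single nonzero coordinate, a unit; but then the sum of the numerator
    has norm 3, while a multiple of 3 has norm divisible by 9. *)
Lemma ct_norm_neq1 (x : Lambda6 R) : hnorm x <> 1.
Proof.
have /ctP[y [hy1 hy2 [f ff hf]] xE] : ctval x \in @ct_pred R by case: x.
rewrite /hnorm /= /ct_hform => h1.
have th3 : cnorm th = 3.
  by apply: complexI; rewrite cnormE conj_theta mulNr theta_sq opprK realC_nat.
have nat z : z \in @eisenstein R -> exists n : nat, cnorm z = n%:R.
  by move=> hz; apply: (cnorm_eis_nat (Eis hz)).
have s3 : \sum_i cnorm (y 0 i) = 3.
  have : \sum_i cnorm (ctval x 0 i) = 1.
    by apply: complexI; rewrite rmorph_sum /= -[RHS]h1; apply: eq_bigr => i _; rewrite cnormE.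
  rewrite xE => h; transitivity (3 * \sum_i cnorm ((th^-1 *: y) 0 i)); last by rewrite h mulr1.
  rewrite mulr_sumr; apply: eq_bigr => i _.
  by rewrite mxE cnormM mulrA -th3 -cnormM mulfV ?theta_neq0 // cnorm1 mul1r.
have [k yk] : exists k, y 0 k = 0.
  apply: contrapT => hn.
  have : \sum_(i < 6) (1 : R) <= \sum_i cnorm (y 0 i).
    apply: ler_sum => i _; have [n hN] := nat _ (hy1 i).
    have : cnorm (y 0 i) != 0 by rewrite cnorm_eq0; apply/eqP => y0; apply: hn; exists i.
    by rewrite hN pnatr_eq0 ler1n lt0n.
  by rewrite s3 sumr_const card_ord; lra.
have [z hz] : exists z : 'I_6 -> R[i], forall i, z i \in @eisenstein R /\ y 0 i = th * z i.
  have /choice[z hz] i : exists z, z \in @eisenstein R /\ y 0 i = th * z.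
    by have [c hc] := hy2 i k; rewrite yk subr0 => ->; exists c.
  by exists z.
have sz : \sum_i cnorm (z i) = 1.
  have h3 : (3 : R) != 0 by rewrite pnatr_eq0.
  apply: (mulfI h3); rewrite mulr_sumr mulr1 -[RHS]s3; apply: eq_bigr => i _.
  by have [_ ->] := hz i; rewrite cnormM th3.
have [j zj] : exists j, cnorm (z j) != 0.
  apply/existsP; rewrite -negb_forall; apply/negP => /forallP h.
  by move/eqP: sz; rewrite big1 ?(eq_sym 0) ?oner_eq0 // => j _; apply/eqP.
have zj1 : 1 <= cnorm (z j).
  have [zin _] := hz j; have [n hN] := nat _ zin.
  by move: zj; rewrite hN pnatr_eq0 ler1n lt0n.
move: sz; rewrite (bigD1 j) //= => sz.
have z0 : 0 <= \sum_(i | i != j) cnorm (z i) by apply: sumr_ge0 => i _; apply: cnorm_ge0.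
have zz : \sum_(i | i != j) cnorm (z i) = 0 by lra.
have zi i : i != j -> z i = 0.
  move=> ij; apply/eqP; rewrite -cnorm_eq0; move/eqP: zz; rewrite psumr_eq0.
    by move=> /allP/(_ i (mem_index_enum _)); rewrite ij.
  by move=> l _; apply: cnorm_ge0.
have [n nf] := nat _ ff.
have : cnorm (3 * f) = 3.
  rewrite -hf subr0 (bigD1 j) //= big1 ?addr0.
    by have [_ ->] := hz j; rewrite cnormM th3; have -> : cnorm (z j) = 1 by [lra]; rewrite mulr1.
  by move=> i ij; have [_ ->] := hz i; rewrite zi // mulr0.
rewrite cnormM nf; have -> : cnorm (3 : R[i]) = 9.
  by rewrite -[3]opprK -(theta_sq R) -mulrN cnormM -conj_theta cnorm_conj th3; ring.
rewrite -natrM => /eqP; rewrite eqr_nat => /eqP; lia.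
Qed.

Lemma rho_form x : hform (rho R) x = val (x.2 0 0).
Proof.
rewrite L_form big1 ?add0r => [|i _]; last first.
  by rewrite [X in X^*](_ : _ = 0) ?conj0 ?mul0r // mxE.
have -> : (rho R).2 0 0 = 0 by rewrite mxE.
have -> : (rho R).2 0 1 = 1 by rewrite mxE.
by rewrite val_eis0 val_eis1 conj0 conj1 mul0r add0r mul1r.
Qed.

(** A norm 1 vector orthogonal to [rho] would have a Coxeter-Todd component of norm 1. *)
Lemma rho_no_frame e q : ~ @frame R (L R) e (rho R) q.
Proof.
move=> fr; have := frame_pe fr ord0; rewrite rho_form => h0.
have := frame_ee fr ord0 ord0; rewrite L_form h0 conj0 mul0r mulr0 !addr0 eqxx.
exact: ct_norm_neq1.
Qed.

Lemma rho_isotropic : isotropic (rho R).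
Proof. by rewrite /isotropic /hnorm rho_form mxE. Qed.

Lemma rho_primitive : primitive (rho R).
Proof.
have r1 : (rho R).2 0 1 = 1 by rewrite mxE.
split=> [|w a rw].
  by apply/eqP => h; move: r1; rewrite h mxE => /eqP; rewrite eq_sym oner_eq0.
by exists (w.2 0 1); rewrite -r1 rw mxE.
Qed.

Lemma LR_form_reflection (c : eis R) (r v : L R) :
  LR_incl (crefl c r v) = LR_incl v + (val c * hform r v) *: LR_incl r.
Proof. by rewrite /crefl addrC LR_inclDZ val_eisM addrC. Qed.

Lemma short_refl_reflection (r : L R) : hform r r = 1 ->
  is_reflection_in (val (eis_six R)) (LR_incl r) (short_refl r).
Proof.
move=> hr v; rewrite LR_form_reflection !LR_form_incl hr divr1 -scaleNr.
congr (_ + _ *: _); rewrite /eis_six val_eisN val_eis_conj val_eis_omega conj_omega.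
by ring.
Qed.

Lemma long_refl_reflection (r : L R) : hform r r = 2 ->
  is_reflection_in (-1) (LR_incl r) (crefl (-1) r).
Proof.
move=> hr v; rewrite LR_form_reflection !LR_form_incl hr -scaleNr.
by congr (_ + _ *: _); rewrite val_eisN val_eis1; field.
Qed.

Lemma six_neq1 : eis_six R != 1.
Proof.
apply/eqP => h; have := congr1 (fun a => val a ^+ 3) h.
rewrite val_six3 val_eis1 expr1n => /eqP.
by rewrite -subr_eq0 -opprD oppr_eq0 -[1 + 1]/(2%:R) pnatr_eq0.
Qed.

Lemma short_group_Reflec0 (f : L R -> L R) : short_group f -> Reflec0 R f.
Proof.
elim=> {f} [f [r hr ->]||f g _ hf _ hg|f g _ hf fg gf].
- apply: gen_in; exists r, (eis_six R); split=> //; last exact: short_refl_reflection.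
    by rewrite -[eis_six R]expr1; apply: eis_six_unit.
  exact: six_neq1.
- exact: gen_id.
- exact: gen_comp.
- exact: gen_inv hf fg gf.
Qed.

Lemma Reflec_Aut (f : L R -> L R) : Reflec R f -> Aut (L R) f.
Proof. by apply: generated_isometry => g []. Qed.

Lemma short_refl_Reflec (r : L R) : hform r r = 1 -> Reflec R (short_refl r).
Proof.
move=> hr; apply: gen_in; split; first exact/crefl_isometry/short_cond.
exists (LR_incl r), (val (eis_six R)), 6%N; split => //.
- by rewrite LR_form_incl hr ltr01.
- by apply/unity_rootP; rewrite -val_eisX eis_six6 val_eis1.
- by rewrite -val_eis1 (inj_eq val_inj) six_neq1.
- exact: short_refl_reflection.
Qed.

Lemma long_refl_Reflec (r : L R) : hform r r = 2 -> Reflec R (crefl (-1) r).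
Proof.
move=> hr; apply: gen_in; split.
  by apply: crefl_isometry; rewrite /crefl_cond hr val_eisN val_eis1 conjN conj1; ring.
exists (LR_incl r), (-1), 2%N; split => //.
- by rewrite LR_form_incl hr ltr0n.
- by apply/unity_rootP; rewrite sqrrN expr1n.
- by rewrite eq_sym -subr_eq0 opprK -[1 + 1]/(2%:R) pnatr_eq0.
- exact: long_refl_reflection.
Qed.

(** Equivalence with a unit multiple of [Lp] would carry the frame to one at [rho]. *)
Lemma rho_deep : exists2 u : eis R, eis_unit u & sequiv (rho R) (u *: deep_cusp Le Lp Lq 0).
Proof.
have [u hu [|h]] := sequiv_cusp L_frame rho_isotropic rho_primitive; last by exists u.
move=> /sequiv_sym[g hg gu]; case: (@rho_no_frame (g \o Le) (g (u *: Lq))).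
rewrite -gu; apply: frame_isometry (short_group_isometry hg).
exact: frame_unit L_frame hu.
Qed.

Lemma sequiv_rho (v : L R) (u : eis R) : eis_unit u -> sequiv v (u *: deep_cusp Le Lp Lq 0) ->
  exists2 a : eis R, eis_unit a & sequiv v (a *: rho R).
Proof.
move=> hu hv; have [w hw /sequiv_sym hr] := rho_deep.
have cw : eis_conj w * w = 1 by apply/conj_cnorm1/cnorm_unit.
exists (u * eis_conj w); first by apply: eis_unitM => //; apply: eis_unit_conj.
apply: sequiv_trans hv _; have := sequivZ (u * eis_conj w) hr.
by rewrite scalerA -mulrA cw mulr1.
Qed.

(** The image of [Lp] belongs to a frame, so it cannot lie in the orbit of [rho]; [generated_cusp]
    then applies. *)
Lemma Aut_Reflec (f : L R -> L R) : Aut (L R) f -> Reflec R f.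
Proof.
move=> hf.
have pprim : primitive Lp.
  split=> [|w a hw].
    apply/eqP => h; have := frame_pq L_frame; rewrite h hform0l => /eqP.
    by rewrite eq_sym oner_eq0.
  exists (hprod Lq w); apply: val_inj; rewrite val_eisM val_hprod val_eis1.
  by rewrite -hformZ -hw (frame_qp L_frame).
have [u hu [h|h]] := sequiv_cusp L_frame
    (isotropic_isometry hf (frame_pp L_frame)) (primitive_isometry hf pprim).
  apply: (generated_cusp L_frame _ _ _ hf hu h).
  - by move=> g [].
  - exact: short_refl_Reflec.
  - exact: long_refl_Reflec.
have [a ha hs] := sequiv_rho hu h.
have ca : eis_conj a * a = 1 by apply/conj_cnorm1/cnorm_unit.
have := sequivZ (eis_conj a) hs; rewrite scalerA ca scale1r => -[g hg gf].
have iu : eis_unit (eis_conj a) by apply: eis_unit_conj.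
case: (@rho_no_frame ((g \o f) \o Le) (g (eis_conj a *: f Lq))).
rewrite -gf; apply: frame_isometry (short_group_isometry hg).
exact: frame_unit (frame_isometry L_frame hf) iu.
Qed.

End CoxeterTodd.

(** * Cusp quotients and the automorphism group of the lattice *)

Theorem theorem6p11 (R : realType) :
  isometric (L R) (I71 R)
  /\ (forall v : L R,
        primitive v -> isotropic v ->
        ~ (exists2 g : L R -> L R, Reflec0 R g &
             exists a : eis R, g v = a *: rho R) ->
        isometric (perp_quotient v) (eis_lattice R 6))
  /\ (Aut (L R) = Reflec R /\ reflective R).
Proof.
split; first exact: frame_lorentz (L_frame R).
split.
  move=> v prim iso nrho; have [u hu [h|h]] := sequiv_cusp (L_frame R) iso prim.
    have [g hg gv] := sequiv_sym h; rewrite -gv.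
    apply: perp_quotient_frame.
    apply: (frame_isometry _ (short_group_isometry hg)).
    exact: frame_unit (L_frame R) hu.
  have [a _ [g hg gv]] := sequiv_rho hu h; case: nrho.
  by exists g; [apply: short_group_Reflec0 | exists a].
have e : Aut (L R) = Reflec R.
  apply: funext => f; apply: propext; split; [exact: Aut_Reflec | exact: Reflec_Aut].
split=> //; split; first by rewrite e.
(* The two groups are equal, so the single coset of the identity suffices. *)
exists 1%N, (fun _ => id); split; first by move=> _; apply: isometry_id.
by move=> g hg; exists ord0, g; rewrite -e.
Qed.
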